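(* Let $(M,g)$ be a Riemannian spin manifold. Suppose that there exists an open subset $U\subset M$ isometric to a Riemannian product $U_1\times U_2$ of two non-Ricci-flat Riemannian manifolds. Then $(M,g)$ does not admit a Ricci Killing spinor.
   Context: $M$ is connected. $\Sigma M$ is the complex spinor bundle, $\nabla$ the spin connection induced by the Levi-Civita connection, $\cdot$ Clifford multiplication with $X\cdot Y\cdot+Y\cdot X\cdot=-2g(X,Y)$, and $\mathrm{Ric}$ is the Ricci tensor viewed as an endomorphism of $TM$. A Ricci Killing spinor is a non-zero spinor field $\psi\in\Gamma(\Sigma M)$ such that, for some constant $\mu\in\mathbb{R}\setminus\{0\}$, $\nabla_X\psi=\mu\,\mathrm{Ric}(X)\cdot\psi$ for all $X\in TM$. *)

(* Defs.v *)
From HB Require Import structures.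
From mathcomp Require Import all_boot all_order all_algebra.
From mathcomp Require Import all_classical all_reals all_analysis.
From mathcomp Require Import complex.

Set Implicit Arguments.
Unset Strict Implicit.
Unset Printing Implicit Defensive.

Import Order.TTheory GRing.Theory Num.Theory.
Import numFieldNormedType.Exports.

Local Open Scope classical_set_scope.
Local Open Scope ring_scope.
Local Open Scope complex_scope.

(* Points and tangent vectors of R^n are row vectors, so a Jacobian J acts on
   tangent vectors by [v *m J]. *)

Section Calculus.
Variables (R : realType) (n : nat).

Definition basis_vec (i : 'I_n) : 'rV[R]_n := delta_mx 0 i.

Definition partial (i : 'I_n) (f : 'rV[R]_n -> R) (x : 'rV[R]_n) : R :=
  'D_(basis_vec i) (f : 'rV[R]_n -> R^o) x.

(* The set V is always open below. *)
Fixpoint Ck (k : nat) (V : set 'rV[R]_n) (f : 'rV[R]_n -> R) : Prop :=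
  match k with
  | 0%N => forall x, V x -> {for x, continuous f}
  | k'.+1 =>
      (forall x, V x -> {for x, continuous f}) /\
      (forall i, (forall x, V x -> derivable (f : 'rV[R]_n -> R^o) x (basis_vec i))
                 /\ Ck k' V (partial i f))
  end.

Definition smooth (V : set 'rV[R]_n) (f : 'rV[R]_n -> R) : Prop :=
  forall k, Ck k V f.

Definition smooth_mx p q (V : set 'rV[R]_n) (F : 'rV[R]_n -> 'M[R]_(p, q)) : Prop :=
  forall i j, smooth V (fun x => F x i j).

Definition csmooth_mx p q (V : set 'rV[R]_n) (F : 'rV[R]_n -> 'M[R[i]]_(p, q)) : Prop :=
  forall i j, smooth V (fun x => complex.Re (F x i j)) /\
              smooth V (fun x => complex.Im (F x i j)).

Definition jacobian m (F : 'rV[R]_n -> 'rV[R]_m) (x : 'rV[R]_n) : 'M[R]_(n, m) :=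
  \matrix_(i, j) partial i (fun y => F y 0 j) x.

Definition cpartial_mx p q (i : 'I_n) (F : 'rV[R]_n -> 'M[R[i]]_(p, q))
    (x : 'rV[R]_n) : 'M[R[i]]_(p, q) :=
  \matrix_(a, b) Complex (partial i (fun y => complex.Re (F y a b)) x)
                         (partial i (fun y => complex.Im (F y a b)) x).

End Calculus.

(* [G x i j] is g(∂_i, ∂_j) at the point with coordinates x. *)

Section LocalGeometry.
Variables (R : realType) (n : nat) (G : 'rV[R]_n -> 'M[R]_n).

(* [christoffel k i j] is Γ^k_{ij}. *)
Definition christoffel (k i j : 'I_n) (x : 'rV[R]_n) : R :=
  2^-1 * \sum_l invmx (G x) k l *
    (partial i (fun y => G y j l) x + partial j (fun y => G y i l) x
     - partial l (fun y => G y i j) x).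

(* The covariant derivative of the vector field V along ∂_i. *)
Definition cov (i : 'I_n) (V : 'rV[R]_n -> 'rV[R]_n) (x : 'rV[R]_n) : 'rV[R]_n :=
  \row_k (partial i (fun y => V y 0 k) x + \sum_j christoffel k i j x * V x 0 j).

(* R(∂_i, ∂_j) ∂_k; the coordinate fields commute. *)
Definition riemann (i j k : 'I_n) (x : 'rV[R]_n) : 'rV[R]_n :=
  cov i (cov j (fun=> basis_vec R k)) x - cov j (cov i (fun=> basis_vec R k)) x.

(* Ric(Y, Z) = tr (X |-> R(X, Y) Z). *)
Definition ricci (x : 'rV[R]_n) : 'M[R]_n :=
  \matrix_(j, k) \sum_i riemann i j k x 0 i.

(* The endomorphism defined by g(Ric(v), w) = Ric(v, w). *)
Definition ricci_endo (x : 'rV[R]_n) (v : 'rV[R]_n) : 'rV[R]_n :=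
  v *m ricci x *m invmx (G x).

Definition inner (x : 'rV[R]_n) (v w : 'rV[R]_n) : R := (v *m G x *m w^T) 0 0.

End LocalGeometry.

(* [cmap] and [cinv] are meaningful only on the domain [cdom] and on the image
   [crange], respectively. *)
Record chart (R : realType) (T : Type) (n : nat) := Chart {
  cdom : set T;
  cmap : T -> 'rV[R]_n;
  cinv : 'rV[R]_n -> T }.

Definition crange (R : realType) (T : Type) n (c : chart R T n) : set 'rV[R]_n :=
  cmap c @` cdom c.

Definition is_chart (R : realType) (T : topologicalType) n (c : chart R T n) : Prop :=
  [/\ open (cdom c), open (crange c),
      (forall p, cdom c p -> cinv c (cmap c p) = p),
      (forall p, cdom c p -> {for p, continuous (cmap c)}) &
      (forall x, crange c x -> {for x, continuous (cinv c)})].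

Definition transition (R : realType) (T : Type) n (c d : chart R T n)
    (x : 'rV[R]_n) : 'rV[R]_n := cmap d (cinv c x).

Definition overlap (R : realType) (T : Type) n (c d : chart R T n) : set 'rV[R]_n :=
  cmap c @` (cdom c `&` cdom d).

Definition compatible (R : realType) (T : Type) n (c d : chart R T n) : Prop :=
  smooth_mx (overlap c d) (transition c d) /\
  smooth_mx (overlap d c) (transition d c).

(* A space with an indexed family of charts and, in each of them, the
   coefficient matrix of a metric. *)
Record riem_data (R : realType) (n : nat) := RiemData {
  carrier :> topologicalType;
  idx : Type;
  atlas : idx -> chart R carrier n;
  metric : idx -> 'rV[R]_n -> 'M[R]_n }.

Section Manifold.
Variables (R : realType) (n : nat) (M : riem_data R n).

(* The smooth structure is a maximal atlas. *)
Definition is_smooth_manifold : Prop :=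
  [/\ hausdorff_space M, @second_countable M,
      (forall c : idx M, is_chart (atlas c)) /\
        (forall p : M, exists c : idx M, cdom (atlas c) p),
      (forall c d : idx M, compatible (atlas c) (atlas d)) &
      (forall k : chart R M n, is_chart k ->
         (forall c : idx M, compatible (atlas c) k) ->
         exists c : idx M, atlas c = k)].

Definition is_metric : Prop :=
  [/\ (forall c : idx M, smooth_mx (crange (atlas c)) (metric c)),
      (forall (c : idx M) x, crange (atlas c) x -> (metric c x)^T = metric c x),
      (forall (c : idx M) x (v : 'rV[R]_n), crange (atlas c) x -> v != 0 ->
         0 < inner (metric c) x v v) &
      (forall (c d : idx M) x, overlap (atlas c) (atlas d) x ->
         let F := transition (atlas c) (atlas d) in
         metric c x = jacobian F x *m metric d (F x) *m (jacobian F x)^T)].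

Definition is_riemannian : Prop := is_smooth_manifold /\ is_metric.

Definition ricci_flat : Prop :=
  forall (c : idx M) x, crange (atlas c) x -> ricci (metric c) x = 0.

End Manifold.

Definition prod_chart (R : realType) (T1 T2 : Type) n1 n2
    (c1 : chart R T1 n1) (c2 : chart R T2 n2) : chart R (T1 * T2)%type (n1 + n2) :=
  {| cdom := cdom c1 `*` cdom c2;
     cmap := fun p => row_mx (cmap c1 p.1) (cmap c2 p.2);
     cinv := fun x => (cinv c1 (lsubmx x), cinv c2 (rsubmx x)) |}.

(* The product charts generate the product smooth structure, but do not form a
   maximal atlas. *)
Definition riem_prod (R : realType) n1 n2 (M1 : riem_data R n1)
    (M2 : riem_data R n2) : riem_data R (n1 + n2) :=
  {| carrier := (M1 * M2)%type : topologicalType;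
     idx := (idx M1 * idx M2)%type;
     atlas := fun c => prod_chart (atlas c.1) (atlas c.2);
     metric := fun c x =>
       block_mx (metric c.1 (lsubmx x)) 0 0 (metric c.2 (rsubmx x)) |}.

(* The open subset U of M, with the induced metric, is isometric to N: there is
   a diffeomorphism f : U -> N, with inverse h, pulling the metric of N back to
   that of M. The two dimensions are not assumed to agree. *)
Definition open_isometric (R : realType) m n (M : riem_data R m) (U : set M)
    (N : riem_data R n) : Prop :=
  open U /\ exists (f : M -> N) (h : N -> M),
    [/\ (forall p, U p -> h (f p) = p) /\ (forall q, U (h q) /\ f (h q) = q),
        (forall p, U p -> {for p, continuous f}) /\ continuous h,
        (forall (c : idx M) (d : idx N),
           smooth_mx (cmap (atlas c) @` (U `&` cdom (atlas c) `&` f @^-1` cdom (atlas d)))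
             (fun x => cmap (atlas d) (f (cinv (atlas c) x)))),
        (forall (c : idx M) (d : idx N),
           smooth_mx (cmap (atlas d) @` (cdom (atlas d) `&` h @^-1` cdom (atlas c)))
             (fun y => cmap (atlas c) (h (cinv (atlas d) y)))) &
        (forall (c : idx M) (d : idx N) p,
           U p -> cdom (atlas c) p -> cdom (atlas d) (f p) ->
           let F := fun x => cmap (atlas d) (f (cinv (atlas c) x)) in
           let x := cmap (atlas c) p in
           metric c x = jacobian F x *m metric d (F x) *m (jacobian F x)^T)].

(* The complex spinor module of dimension 2^[n/2]. By dimension count, any
   matrices with these relations form an irreducible complex representation of
   Cl_n; [gamma j] is Clifford multiplication by the j-th standard basis
   vector. *)
Notation spinor_rank n := (2 ^ n./2)%N.

Section Clifford.
Variables (R : realType) (n N : nat) (gamma : 'I_n -> 'M[R[i]]_N).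

Definition clifford_rep : Prop :=
  forall j k, gamma j *m gamma k + gamma k *m gamma j = (- ((j == k)%:R *+ 2))%:M.

Definition clifford (v : 'rV[R]_n) : 'M[R[i]]_N :=
  \sum_j (v 0 j)%:C *: gamma j.

(* The image of Spin(n) = {v_1 ... v_2k : |v_i| = 1} in GL(N, C). For n >= 1
   and N = 2^[n/2] the representation is faithful on the even part of Cl_n, so
   that this is Spin(n) itself; the double cover to SO(n) is
   s |-> (v |-> s v s^-1). *)
Definition spin_group : set 'M[R[i]]_N :=
  [set s | exists vs : seq 'rV[R]_n,
     [/\ (forall v, v \in vs -> \sum_j v 0 j ^+ 2 = 1), ~~ odd (size vs) &
         s = \big[mulmx/1%:M]_(v <- vs) clifford v]].

End Clifford.

Lemma clifford_rep_exists (R : realType) (n : nat) :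
  exists gamma : 'I_n -> 'M[R[i]]_(spinor_rank n), clifford_rep gamma.
Proof.
suff H (m : nat) : forall b : bool, exists gamma : nat -> 'M[R[i]]_(2 ^ m),
    forall j k, (j < b + m.*2)%N -> (k < b + m.*2)%N ->
      gamma j *m gamma k + gamma k *m gamma j = (- ((j == k)%:R *+ 2))%:M.
  have [g Hg] := H n./2 (odd n); exists (fun i : 'I_n => g i) => j k.
  by rewrite Hg // odd_double_half.
elim: m => [|m IH] b.
  exists (fun=> ('i%C : R[i])%:M) => j k; rewrite addn0 => jb kb.
  have -> : j = 0%N by case: b jb {kb}; case: j.
  have -> : k = 0%N by case: b kb {jb}; case: k.
  by rewrite -scalar_mxM -raddfD /= -expr2 sqr_i mulr2n opprD.
have [g Hg] := IH b; set d := (b + m.*2)%N in Hg.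
have E : (2 ^ m + 2 ^ m = 2 ^ m.+1)%N by rewrite addnn -mul2n expnS.
rewrite -E doubleS !addnS -/d.
exists (fun j => if (j < d)%N then block_mx 0 (g j) (g j) 0
  else if j == d then block_mx 0 1%:M (- 1%:M) 0
  else block_mx (('i%C : R[i])%:M) 0 0 (- (('i%C : R[i])%:M))) => j k jd kd.
have II : ('i%C : R[i]) * ('i%C : R[i]) = -1 by rewrite -expr2 sqr_i.
have sc (x : R[i]) : (x%:M : 'M[R[i]]_(2 ^ m + 2 ^ m)) = block_mx x%:M 0 0 x%:M
  by rewrite scalar_mx_block.
have Z : ((- (0%:R *+ 2) : R[i])%:M : 'M[R[i]]_(2 ^ m)) = 0
  by rewrite mul0rn oppr0 raddf0.
have T : ((- (1%:R *+ 2) : R[i])%:M : 'M[R[i]]_(2 ^ m)) = - 1%:M - 1%:M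
  by rewrite mulr2n opprD raddfD /= !raddfN.
have jk : (d <= j -> j = d \/ j = d.+1)%N.
  by move=> dj; have := jd; rewrite ltnS leq_eqVlt ltnS => /orP[/eqP|];
     [right|left; apply/eqP; rewrite eqn_leq dj andbT].
have kk : (d <= k -> k = d \/ k = d.+1)%N.
  by move=> dj; have := kd; rewrite ltnS leq_eqVlt ltnS => /orP[/eqP|];
     [right|left; apply/eqP; rewrite eqn_leq dj andbT].
rewrite sc; case: (ltnP j d) => [jl|/jk[]->]; case: (ltnP k d) => [kl|/kk[]->];
  rewrite ?eqxx ?(gtn_eqF (ltnSn d)) ?(ltn_eqF (ltnSn d)) ?(ltn_eqF jl)
    ?(gtn_eqF kl) ?(ltn_eqF (ltnW jl : (j < d.+1)%N))
    ?(gtn_eqF (ltnW kl : (k < d.+1)%N)) ?Z ?T !mulmx_block add_block_mx.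
all: try by rewrite !(mul0mx, mulmx0, add0r, addr0, Hg).
all: rewrite !(mul0mx, mulmx0, add0r, addr0,
  mulmx1, mul1mx, mulNmx, mulmxN, opprK, subrr, addNr) -?scalar_mxM ?II
  ?raddfN //=.
all: by rewrite ?mul_scalar_mx ?mul_mx_scalar ?subrr ?addNr.
Qed.

(* A spin structure as a lift to Spin(n) of the transition functions of the
   oriented orthonormal frame bundle. Each index a carries a local orthonormal
   frame (e_{a,j})_j over [sdom a], whose j-th vector has coordinates
   [row j (frame a c x)] in the chart c, and [lift a b] is the transition
   function of the Spin(n)-principal bundle over the overlap of a and b. *)
Record spin_data (R : realType) n (M : riem_data R n) (N : nat) := SpinData {
  sidx : Type;
  sdom : sidx -> set M;
  frame : sidx -> idx M -> 'rV[R]_n -> 'M[R]_n;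
  lift : sidx -> sidx -> M -> 'M[R[i]]_N }.

Section Spin.
Variables (R : realType) (n : nat) (M : riem_data R n).
Let N := spinor_rank n.
Variables (gamma : 'I_n -> 'M[R[i]]_N) (S : spin_data M N).

Definition smooth_frames : Prop :=
  forall (a : sidx S) (c : idx M),
    let V := cmap (atlas c) @` (cdom (atlas c) `&` sdom a) in
    [/\ smooth_mx V (frame a c),
        (forall x, V x -> frame a c x *m metric c x *m (frame a c x)^T = 1%:M) &
        (forall (d : idx M) p, sdom a p -> cdom (atlas c) p -> cdom (atlas d) p ->
           frame a d (cmap (atlas d) p) =
           frame a c (cmap (atlas c) p) *m
             jacobian (transition (atlas c) (atlas d)) (cmap (atlas c) p))].

(* Since e_{b,j} = \sum_k g(e_{b,j}, e_{a,k}) e_{a,k}, the equation says that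
   [lift a b] covers the change of frames between a and b. *)
Definition lifts_frames : Prop :=
  forall (a b : sidx S) (c : idx M) p,
    sdom a p -> sdom b p -> cdom (atlas c) p ->
    let x := cmap (atlas c) p in
    forall j, lift a b p *m gamma j =
      clifford gamma (\row_k inner (metric c) x (row j (frame b c x))
                                                (row k (frame a c x)))
      *m lift a b p.

Definition is_spin_structure : Prop :=
  [/\ (forall a : sidx S, open (sdom a)) /\ (forall p, exists a : sidx S, sdom a p),
      smooth_frames,
      (forall (a b : sidx S) p, sdom a p -> sdom b p -> spin_group gamma (lift a b p)) /\
        (forall (a b : sidx S) (c : idx M),
           csmooth_mx (cmap (atlas c) @` (cdom (atlas c) `&` (sdom a `&` sdom b)))
             (fun x => lift a b (cinv (atlas c) x))),
      (forall (a b c : sidx S) p, sdom a p -> sdom b p -> sdom c p ->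
         lift a b p *m lift b c p = lift a c p) &
      lifts_frames].

(* A smooth section of the associated bundle: [psi a] is the component of the
   spinor field in the trivialization a. *)
Definition is_spinor_field (psi : sidx S -> M -> 'cV[R[i]]_N) : Prop :=
  (forall (a : sidx S) (c : idx M),
     csmooth_mx (cmap (atlas c) @` (cdom (atlas c) `&` sdom a))
       (fun x => psi a (cinv (atlas c) x))) /\
  (forall (a b : sidx S) p, sdom a p -> sdom b p ->
     psi a p = lift a b p *m psi b p).

(* In a frame e_1, ..., e_n:
   X . psi = \sum_j g(X, e_j) e_j . psi   and
   nabla_X psi = X(psi) + 1/4 \sum_(j, k) g(nabla_X e_j, e_k) e_j . e_k . psi. *)

Definition clifford_mult (a : sidx S) (c : idx M) (x v : 'rV[R]_n) : 'M[R[i]]_N :=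
  clifford gamma (\row_j inner (metric c) x v (row j (frame a c x))).

Definition spin_nabla (psi : sidx S -> M -> 'cV[R[i]]_N) (a : sidx S) (c : idx M)
    (x v : 'rV[R]_n) : 'cV[R[i]]_N :=
  \sum_i (v 0 i)%:C *:
    (cpartial_mx i (fun y => psi a (cinv (atlas c) y)) x +
     4^-1 *: \sum_j \sum_k
       (inner (metric c) x (cov (metric c) i (fun y => row j (frame a c y)) x)
                           (row k (frame a c x)))%:C *:
         (gamma j *m (gamma k *m psi a (cinv (atlas c) x)))).

Definition ricci_killing_spinor (psi : sidx S -> M -> 'cV[R[i]]_N) : Prop :=
  [/\ is_spinor_field psi,
      (exists (a : sidx S) p, sdom a p /\ psi a p <> 0) &
      exists2 mu : R, mu <> 0 &
        forall (a : sidx S) (c : idx M) p, sdom a p -> cdom (atlas c) p ->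
          let x := cmap (atlas c) p in
          forall v : 'rV[R]_n,
            spin_nabla psi a c x v =
            mu%:C *: (clifford_mult a c x (ricci_endo (metric c) x v) *m psi a p)].

End Spin.

(* Main.v *)
From HB Require Import structures.
From mathcomp Require Import all_boot all_order all_algebra.
From mathcomp Require Import all_classical all_reals all_analysis.
From mathcomp Require Import complex.
From mathcomp Require Import ring lra.
Require Import Defs.

Set Implicit Arguments.
Unset Strict Implicit.
Unset Printing Implicit Defensive.

Import Order.TTheory GRing.Theory Num.Theory.
Import numFieldNormedType.Exports.

Local Open Scope classical_set_scope.
Local Open Scope ring_scope.

(** Let psi be a Ricci Killing spinor. In a chart and a trivialization the
    equation nabla_X psi = mu Ric(X) . psi is a linear first-order system
    d_i psi = B_i psi with smooth coefficients ([local_killing]). Uniqueness for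
    such systems ([linear_system_unique]) makes the zero set of psi open; it is
    closed as well, and the manifold is connected, so that psi, being nonzero
    somewhere, vanishes nowhere ([ricci_killing_nowhere_zero]).

    The system is overdetermined. Since second derivatives commute ([partialC]),
    psi is killed by d_i B_j - d_j B_i + [B_j, B_i]. The connection part of this
    matrix is, up to sign, the spin curvature, that is, the image under the spin
    representation of the Riemann curvature ([frame_curvature],
    [comm_spin_spin]); the part linear in mu is Clifford multiplication by
    (nabla_i Ric)(d_j) - (nabla_j Ric)(d_i), because the spin connection is
    compatible with Clifford multiplication ([comm_spin_cliff]); and the part
    quadratic in mu is the commutator of Ric(d_i) and Ric(d_j) in the Clifford
    algebra. Hence, if the first two parts vanish, that commutator kills psi
    ([killing_integrability]).

    They do vanish on a product when d_i is tangent to the first factor and d_j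
    to the second: the mixed curvature is zero ([curvature_prod_lr]) and the
    Ricci endomorphism of each factor is parallel along the other one
    ([cov_ricci_field_prod_rl], [cov_ricci_field_prod_lr]). Moreover Ric(d_i) and
    Ric(d_j) are then orthogonal, so they anticommute, and twice their Clifford
    product kills psi. The Clifford square of a vector v is -|v|^2; as neither
    factor is Ricci-flat, there are a point and indices i, j at which both
    vectors are nonzero, and there psi would be zero ([killing_spinor_eq0]).

    The product coordinates belong to the maximal atlas of the manifold
    ([product_chart]) once both spaces are known to have the same dimension
    ([isometric_dim], which rests on the chain rule [partial_comp]). The analysis
    is carried out over the reals: spinors are replaced by their real and
    imaginary parts, and complex matrices by the real matrices of their action. *)

(** * Partial derivatives and functions of class C^k *)

Lemma continuous_ext (T U : topologicalType) (f g : T -> U) (V : set T) x :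
  open V -> V x -> (forall y, V y -> f y = g y) ->
  {for x, continuous f} -> {for x, continuous g}.
Proof.
move=> oV Vx fg cf; rewrite /prop_for /continuous_at -(fg x Vx).
apply: cvg_trans cf; apply: (@near_eq_cvg _ _ (nbhs x)).
near=> y; apply: fg; near: y; exact: (open_nbhs_nbhs (conj oV Vx)).
Unshelve. all: by end_near. Qed.

Notation derivable_along i f x :=
  (derivable (f : 'rV[_]_(_) -> _^o) x (basis_vec _ i)).

Section PartialDerivatives.
Variables (R : realType) (n : nat).
Implicit Types (f g : 'rV[R]_n -> R) (V W : set 'rV[R]_n) (x : 'rV[R]_n).

Lemma partial_near i f g x : (\near x, f x = g x) -> partial i f x = partial i g x.
Proof. exact: near_eq_derive. Qed.

Lemma partial_ext i f g V x : open V -> V x -> (forall y, V y -> f y = g y) ->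
  partial i f x = partial i g x.
Proof.
by move=> oV Vx fg; apply: partial_near; apply: filterS (open_nbhs_nbhs (conj oV Vx)).
Qed.

Lemma derivable_ext i f g V x : open V -> V x -> (forall y, V y -> f y = g y) ->
  derivable_along i f x -> derivable_along i g x.
Proof.
move=> oV Vx fg; apply: near_eq_derivable.
by apply: filterS (open_nbhs_nbhs (conj oV Vx)).
Qed.

Lemma partial_cst i (a : R) x : partial i (fun=> a) x = 0.
Proof. exact: derive_cst. Qed.

Lemma partialD i f g x : derivable_along i f x -> derivable_along i g x ->
  partial i (fun y => f y + g y) x = partial i f x + partial i g x.
Proof. exact: deriveD. Qed.

Lemma partialM i f g x : derivable_along i f x -> derivable_along i g x ->
  partial i (fun y => f y * g y) x = partial i f x * g x + f x * partial i g x.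
Proof.
by move=> df dg; rewrite /partial (deriveM df dg) addrC; congr (_ + _); rewrite mulrC.
Qed.

Lemma Ck_continuous k V f : Ck k V f -> forall x, V x -> {for x, continuous f}.
Proof. by case: k => [//|k] []. Qed.

Lemma Ck_derivable k V f : Ck k.+1 V f -> forall i x, V x -> derivable_along i f x.
Proof. by move=> [_ H] i; have [] := H i. Qed.

Lemma Ck_partial k V f i : Ck k.+1 V f -> Ck k V (partial i f).
Proof. by move=> [_ H]; have [] := H i. Qed.

Lemma Ck_le k V f : Ck k.+1 V f -> Ck k V f.
Proof.
elim: k f => [|k IH] f; first by case.
move=> [cf H]; split=> // i; have [df Cf] := H i; split=> //; exact: IH.
Qed.

Lemma Ck_sub k V W f : W `<=` V -> Ck k V f -> Ck k W f.
Proof.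
move=> WV; elim: k f => [|k IH] f; first by move=> cf x /WV/cf.
move=> [cf H]; split; first by move=> x /WV/cf.
by move=> i; have [df Cf] := H i; split=> [x /WV/df //|]; exact: IH.
Qed.

Lemma Ck_ext k V f g : open V -> (forall y, V y -> f y = g y) -> Ck k V f -> Ck k V g.
Proof.
move=> oV; elim: k f g => [|k IH] f g fg.
  by move=> cf x Vx; apply: (continuous_ext oV Vx fg); exact: cf.
move=> [cf H]; split; first by move=> x Vx; apply: (continuous_ext oV Vx fg); exact: cf.
move=> i; have [df Cf] := H i; split.
  by move=> x Vx; apply: (derivable_ext oV Vx fg); exact: df.
by apply: IH Cf => y Vy; exact: partial_ext oV Vy fg.
Qed.

Lemma Ck_cst k V (a : R) : Ck k V (fun=> a).
Proof.
elim: k a => [|k IH] a; first by move=> x _; exact: cst_continuous.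
split; first by move=> x _; exact: cst_continuous.
move=> i; split; first by move=> x _; exact: derivable_cst.
by rewrite (_ : partial i _ = fun=> 0); [exact: IH|apply/funext => x; exact: partial_cst].
Qed.

Lemma CkD k V f g : open V -> Ck k V f -> Ck k V g -> Ck k V (fun y => f y + g y).
Proof.
move=> oV; elim: k f g => [|k IH] f g.
  by move=> cf cg x Vx; exact: (continuousD (cf x Vx) (cg x Vx)).
move=> [cf Hf] [cg Hg]; split.
  by move=> x Vx; exact: (continuousD (cf x Vx) (cg x Vx)).
move=> i; have [df Cf] := Hf i; have [dg Cg] := Hg i; split.
  by move=> x Vx; apply: derivableD; [exact: df|exact: dg].
apply: (Ck_ext oV _ (IH _ _ Cf Cg)) => y Vy.
by rewrite partialD //; [exact: df|exact: dg].
Qed.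

Lemma CkM k V f g : open V -> Ck k V f -> Ck k V g -> Ck k V (fun y => f y * g y).
Proof.
move=> oV; elim: k f g => [|k IH] f g.
  by move=> cf cg x Vx; exact: (continuousM (cf x Vx) (cg x Vx)).
move=> Hf Hg; split.
  by move=> x Vx; exact: (continuousM (Ck_continuous Hf Vx) (Ck_continuous Hg Vx)).
move=> i; split.
  move=> x Vx; apply: derivableM; first exact: (Ck_derivable Hf).
  exact: (Ck_derivable Hg).
apply: (@Ck_ext _ _ (fun y => partial i f y * g y + f y * partial i g y)) => //.
  by move=> y Vy; rewrite partialM //; [exact: (Ck_derivable Hf)|exact: (Ck_derivable Hg)].
apply: CkD => //; apply: IH; [exact: Ck_partial|exact: Ck_le|exact: Ck_le|exact: Ck_partial].
Qed.

Lemma smooth_ext V f g : open V -> (forall y, V y -> f y = g y) ->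
  smooth V f -> smooth V g.
Proof. by move=> oV fg sf k; apply: Ck_ext fg _. Qed.

Lemma smooth_sub V W f : W `<=` V -> smooth V f -> smooth W f.
Proof. by move=> WV sf k; apply: Ck_sub WV _. Qed.

Lemma smooth_cst V (a : R) : smooth V (fun=> a).
Proof. by move=> k; exact: Ck_cst. Qed.

Lemma smoothD V f g : open V -> smooth V f -> smooth V g -> smooth V (fun y => f y + g y).
Proof. by move=> oV sf sg k; apply: CkD. Qed.

Lemma smoothM V f g : open V -> smooth V f -> smooth V g -> smooth V (fun y => f y * g y).
Proof. by move=> oV sf sg k; apply: CkM. Qed.

Lemma smoothN V f : open V -> smooth V f -> smooth V (fun y => - f y).
Proof.
move=> oV sf; apply: (@smooth_ext _ (fun y => -1 * f y)) => //.
  by move=> y _; rewrite mulN1r.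
by apply: smoothM => //; exact: smooth_cst.
Qed.

Lemma smooth_partial V f i : smooth V f -> smooth V (partial i f).
Proof. by move=> sf k; apply: Ck_partial. Qed.

Lemma smooth_sum V (I : finType) (F : I -> 'rV[R]_n -> R) : open V ->
  (forall a, smooth V (F a)) -> smooth V (fun y => \sum_a F a y).
Proof.
move=> oV sF; have : forall s : seq I, smooth V (fun y => \sum_(a <- s) F a y); last exact.
elim=> [|a s IH].
  apply: (@smooth_ext _ (fun=> 0)) => //; last exact: smooth_cst.
  by move=> y _; rewrite big_nil.
apply: (@smooth_ext _ (fun y => F a y + \sum_(b <- s) F b y)) => //.
  by move=> y _; rewrite big_cons.
exact: smoothD.
Qed.

Lemma smooth_continuous V f x : smooth V f -> V x -> {for x, continuous f}.
Proof. by move=> sf; apply: Ck_continuous (sf 0%N) x. Qed.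

Lemma smooth_derivable V f i x : smooth V f -> V x -> derivable_along i f x.
Proof. by move=> sf; apply: Ck_derivable (sf 1%N) i x. Qed.

Lemma partial_sum V (I : finType) (F : I -> 'rV[R]_n -> R) i x : open V -> V x ->
  (forall a, smooth V (F a)) ->
  partial i (fun y => \sum_a F a y) x = \sum_a partial i (F a) x.
Proof.
move=> oV Vx sF; suff : forall s : seq I, partial i (fun y => \sum_(a <- s) F a y) x
    = \sum_(a <- s) partial i (F a) x /\ smooth V (fun y => \sum_(a <- s) F a y).
  by move=> /(_ (index_enum I))[].
elim=> [|a s [IH IHs]].
  rewrite big_nil; split.
    by rewrite (_ : (fun _ => _) = fun=> 0) ?partial_cst//; apply/funext => y; rewrite big_nil.
  apply: (@smooth_ext _ (fun=> 0)) => //; last exact: smooth_cst.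
  by move=> y _; rewrite big_nil.
have E : (fun y => \sum_(b <- a :: s) F b y) = (fun y => F a y + \sum_(b <- s) F b y).
  by apply/funext => y; rewrite big_cons.
rewrite E; split; last exact: smoothD.
rewrite partialD ?big_cons ?IH //; first exact: smooth_derivable (sF a) Vx.
exact: smooth_derivable IHs Vx.
Qed.

End PartialDerivatives.

(** * Mean value theorems along the coordinate axes *)

Section MeanValue.
Variables (R : realType) (n : nat).
Implicit Types (f g : 'rV[R]_n -> R) (V W : set 'rV[R]_n) (x y z : 'rV[R]_n).

Lemma is_derive_axis i f x (t : R) : derivable_along i f (x + t *: basis_vec R i) ->
  is_derive t (1 : R) (fun s => f (x + s *: basis_vec R i))
    (partial i f (x + t *: basis_vec R i)).
Proof.
move=> df.
have E : (fun h : R => h^-1 *: (((fun s => f (x + s *: basis_vec R i) : R^o) \o shift t)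
            (h *: (1 : R)) - f (x + t *: basis_vec R i))) =
         (fun h => h^-1 *: (((f : _ -> R^o) \o shift (x + t *: basis_vec R i))
            (h *: basis_vec R i) - f (x + t *: basis_vec R i))).
  apply/funext => h /=; rewrite [h *: 1]mulr1 scalerDl addrCA.
  by [].
apply: DeriveDef; first by rewrite /derivable E.
by rewrite /partial /derive E.
Qed.

Lemma mean_value_axis i f x (t : R) :
  (forall s, `|s| <= `|t| -> derivable_along i f (x + s *: basis_vec R i)) ->
  exists2 s, `|s| <= `|t| &
    f (x + t *: basis_vec R i) - f x = t * partial i f (x + s *: basis_vec R i).
Proof.
move=> df; pose g s := f (x + s *: basis_vec R i).
pose g' s := partial i f (x + s *: basis_vec R i).
have dg s : `|s| <= `|t| -> is_derive s (1 : R) g (g' s).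
  by move=> /df ?; exact: is_derive_axis.
have g0 : g 0 = f x by rewrite /g scale0r addr0.
rewrite -g0 -/(g t); have [t0|t0] := leP 0 t.
  have inI s : s \in `[0, t] -> `|s| <= `|t|.
    by rewrite in_itv /= => /andP[s0 st]; rewrite !ger0_norm.
  have [c cI ->] : exists2 c, c \in `[0, t] & g t - g 0 = g' c * (t - 0).
    apply: MVT_segment => //.
      by move=> s sI; apply/dg/inI; exact: subset_itv_oo_cc sI.
    by apply: derivable_within_continuous => s /inI/dg[].
  by exists c; [exact: inI|rewrite subr0 mulrC].
have inI s : s \in `[t, 0] -> `|s| <= `|t|.
  by rewrite in_itv /= => /andP[s0 st]; rewrite (ltr0_norm t0) ler0_norm// lerN2.
have [c cI e] : exists2 c, c \in `[t, 0] & g 0 - g t = g' c * (0 - t).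
  apply: MVT_segment; first exact: ltW.
    by move=> s sI; apply/dg/inI; exact: subset_itv_oo_cc sI.
  by apply: derivable_within_continuous => s /inI/dg[].
by exists c; [exact: inI|rewrite -opprB e sub0r mulrN opprK mulrC].
Qed.

(** Changing one coordinate at a time leads from [x] to [y] inside the box with
    these opposite corners, and every step is a mean value theorem along an axis. *)
Lemma mean_value_box f x y :
  (forall i z, (forall k, `|z 0 k - x 0 k| <= `|y 0 k - x 0 k|) ->
     derivable_along i f z) ->
  exists2 z : 'I_n -> 'rV[R]_n,
    (forall i k, `|z i 0 k - x 0 k| <= `|y 0 k - x 0 k|) &
    f y - f x = \sum_i (y 0 i - x 0 i) * partial i f (z i).
Proof.
move=> df.
pose w m : 'rV[R]_n := \row_k if (k < m)%N then y 0 k else x 0 k.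
have wS (i : 'I_n) : w i.+1 = w i + (y 0 i - x 0 i) *: basis_vec R i.
  apply/rowP => k; rewrite !mxE eqxx /= ltnS.
  have [->|ki] := eqVneq k i; first by rewrite leqnn ltnn mulr1 addrC subrK.
  by rewrite mulr0 addr0 leq_eqVlt (inj_eq val_inj) (negPf ki).
have box (i : 'I_n) s k : `|s| <= `|y 0 i - x 0 i| ->
    `|(w i + s *: basis_vec R i) 0 k - x 0 k| <= `|y 0 k - x 0 k|.
  move=> si; rewrite !mxE eqxx /=.
  have [->|ki] := eqVneq k i; first by rewrite ltnn mulr1 addrAC subrr add0r.
  by rewrite mulr0 addr0; case: ifP; rewrite // subrr normr0.
have [s sb sE] : exists2 s : 'I_n -> R, forall i, `|s i| <= `|y 0 i - x 0 i| &
    forall i : 'I_n, f (w i.+1) - f (w i) =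
      (y 0 i - x 0 i) * partial i f (w i + s i *: basis_vec R i).
  have /choice[s sP] (i : 'I_n) : exists s, `|s| <= `|y 0 i - x 0 i| /\
    f (w i.+1) - f (w i) = (y 0 i - x 0 i) * partial i f (w i + s *: basis_vec R i).
    have [s sb sE] : exists2 s, `|s| <= `|y 0 i - x 0 i| &
      f (w i + (y 0 i - x 0 i) *: basis_vec R i) - f (w i) =
      (y 0 i - x 0 i) * partial i f (w i + s *: basis_vec R i).
      by apply: mean_value_axis => s si; apply: df => k; exact: box.
    by exists s; rewrite wS.
  by exists s => i; case: (sP i).
exists (fun i : 'I_n => w i + s i *: basis_vec R i).
  by move=> i k; exact: box.
under eq_bigr => i _ do rewrite -sE.
rewrite -(big_mkord xpredT (fun i => f (w i.+1) - f (w i))) telescope_sumr //.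
congr (f _ - f _); apply/rowP => k; rewrite mxE ?ltn_ord //.
Qed.

Lemma nbhs_box x V : nbhs x V -> exists2 e : R, 0 < e &
  forall y, (forall k, `|y 0 k - x 0 k| < e) -> V y.
Proof.
move=> /nbhs_ballP[e /= e0 H]; exists e => // y yx; apply: H; split => // i k.
by rewrite ord1 /ball /= distrC.
Qed.

(** The left-hand side is symmetric in [i] and [j], so that both orders of
    differentiation can be compared through it. *)
Lemma second_difference i j f V x (e s : R) :
  (forall y, (forall k, `|y 0 k - x 0 k| < e) -> V y) ->
  Ck 2 V f -> 0 <= s -> s + s < e ->
  exists2 z : 'rV[R]_n, forall k, `|z 0 k - x 0 k| <= s + s &
    f (x + s *: basis_vec R i + s *: basis_vec R j) - f (x + s *: basis_vec R i)
      - f (x + s *: basis_vec R j) + f x =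
    s * s * partial j (partial i f) z.
Proof.
move=> boxV Cf s0 se.
have box a b k : `|a| <= s -> `|b| <= s ->
    `|(x + a *: basis_vec R i + b *: basis_vec R j) 0 k - x 0 k| <= s + s.
  move=> ab bb; rewrite !mxE eqxx /=.
  rewrite [X in `|X|](_ : _ = a * (k == i)%:R + b * (k == j)%:R); last by ring.
  rewrite (le_trans (ler_normD _ _)) // lerD // normrM.
    by rewrite (le_trans _ ab) // ler_piMr //; case: eqP => _; rewrite ?normr1 ?normr0.
  by rewrite (le_trans _ bb) // ler_piMr //; case: eqP => _; rewrite ?normr1 ?normr0.
have inV a b : `|a| <= s -> `|b| <= s -> V (x + a *: basis_vec R i + b *: basis_vec R j).
  by move=> ab bb; apply: boxV => k; apply: le_lt_trans se; exact: box.
have inV0 a : `|a| <= s -> V (x + a *: basis_vec R i).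
  by move=> ab; have := inV a 0 ab; rewrite scale0r addr0; apply; rewrite normr0.
(* The mean value theorem is applied along [i] to the increment of [f] along [j],
   then along [j] to the partial derivative of [f] along [i]. *)
pose g y := f (y + s *: basis_vec R j) - f y.
have sh y : derivable_along i f (y + s *: basis_vec R j) ->
    derivable_along i (fun y => f (y + s *: basis_vec R j)) y /\
    partial i (fun y => f (y + s *: basis_vec R j)) y = partial i f (y + s *: basis_vec R j).
  have E : (fun h : R => h^-1 *: (((fun y => f (y + s *: basis_vec R j) : R^o) \o shift y)
            (h *: basis_vec R i) - f (y + s *: basis_vec R j))) =
         (fun h => h^-1 *: (((f : _ -> R^o) \o shift (y + s *: basis_vec R j))
            (h *: basis_vec R i) - f (y + s *: basis_vec R j))).
    by apply/funext => h /=; rewrite addrA.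
  by rewrite /derivable /partial /derive E.
have sN : `|s| <= s by rewrite ger0_norm.
have [a ab aE] : exists2 a, `|a| <= `|s| &
    g (x + s *: basis_vec R i) - g x = s * partial i g (x + a *: basis_vec R i).
  apply: mean_value_axis => a; rewrite (ger0_norm s0) => ab.
  have [d1 _] := sh _ (Ck_derivable Cf (inV _ _ ab sN)).
  exact: (derivableB d1 (Ck_derivable Cf (inV0 _ ab))).
rewrite (ger0_norm s0) in ab.
have dgE : partial i g (x + a *: basis_vec R i) =
    partial i f (x + a *: basis_vec R i + s *: basis_vec R j)
      - partial i f (x + a *: basis_vec R i).
  have [d1 e1] := sh _ (Ck_derivable Cf (inV _ _ ab sN)).
  by rewrite -e1; exact: (deriveB d1 (Ck_derivable Cf (inV0 _ ab))).
have [b bb bE] : exists2 b, `|b| <= `|s| &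
    partial i f (x + a *: basis_vec R i + s *: basis_vec R j)
      - partial i f (x + a *: basis_vec R i) =
    s * partial j (partial i f) (x + a *: basis_vec R i + b *: basis_vec R j).
  apply: mean_value_axis => b; rewrite (ger0_norm s0) => bb.
  exact: (Ck_derivable (Ck_partial i Cf) (inV _ _ ab bb)).
rewrite (ger0_norm s0) in bb.
exists (x + a *: basis_vec R i + b *: basis_vec R j); first by move=> k; exact: box.
rewrite -mulrA -bE -dgE -aE /g.
move: (f (x + _ + _)) (f (x + s *: basis_vec R i)) (f (x + s *: basis_vec R j)) (f x).
by move=> A B C D; rewrite opprB addrA addrAC.
Qed.

(** Schwarz's theorem: in every small square at [x] the two mixed derivatives
    share a value, each at a point of its own, and both are continuous at [x]. *)
Lemma partialC i j f V x : open V -> V x -> Ck 2 V f ->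
  partial i (partial j f) x = partial j (partial i f) x.
Proof.
move=> oV Vx Cf.
have [e e0 boxV] := nbhs_box (open_nbhs_nbhs (conj oV Vx)).
have close (g : 'rV[R]_n -> R) : {for x, continuous g} -> forall d : R, 0 < d ->
    exists2 r : R, 0 < r & forall z, (forall k, `|z 0 k - x 0 k| < r) -> `|g z - g x| < d.
  move=> cg d d0; have : \forall z \near x, `|g z - g x| < d.
    by have /cvgr_dist_lt /(_ d d0) := cg; apply: filterS => z; rewrite distrC.
  by move=> /nbhs_box.
have cij k l : {for x, continuous (partial k (partial l f))}.
  exact: (Ck_continuous (Ck_partial k (Ck_partial l Cf)) Vx).
apply/eqP/negPn/negP => ne.
set A := partial i _ x in ne *; set B := partial j _ x in ne *.
have d0 : 0 < `|A - B| / 2 by rewrite divr_gt0 // normr_gt0 subr_eq0.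
have [r1 r10 H1] := close _ (cij i j) _ d0.
have [r2 r20 H2] := close _ (cij j i) _ d0.
(* The point found in the square is within [s + s] of [x] in every coordinate. *)
pose s := Num.min e (Num.min r1 r2) / 4.
have m0 : 0 < Num.min e (Num.min r1 r2) by rewrite !lt_min e0 r10 r20.
have s0 : 0 < s by rewrite divr_gt0.
have ss : s + s < Num.min e (Num.min r1 r2).
  by rewrite /s; move: m0; set m := Num.min _ _ => m0; lra.
move: ss; rewrite !lt_min => /and3P[se sr1 sr2].
have [p pb pE] := second_difference i j boxV Cf (ltW s0) se.
have [q qb qE] := second_difference j i boxV Cf (ltW s0) se.
have pq : partial j (partial i f) p = partial i (partial j f) q.
  have ss0 : s * s != 0 by rewrite mulf_neq0 // gt_eqF.
  apply: (mulfI ss0); refine (etrans (esym pE) (etrans _ qE)).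
  rewrite [x + s *: basis_vec R i + _]addrAC.
  move: (f (x + _ + _)) (f (x + s *: basis_vec R i)) (f (x + s *: basis_vec R j)) (f x).
  by move=> C D E F; rewrite [C - D - E]addrAC.
have a1 : `|partial i (partial j f) q - A| < `|A - B| / 2.
  by apply: H1 => k; exact: le_lt_trans (qb k) sr1.
have a2 : `|partial j (partial i f) p - B| < `|A - B| / 2.
  by apply: H2 => k; exact: le_lt_trans (pb k) sr2.
rewrite pq in a2; move: a1 a2 {ne d0 H1 H2 pE qE pq cij}.
move: (partial i (partial j f) q) => Q; clearbody A B => a1 a2.
by have := ltrD a1 a2; rewrite -splitr (distrC Q A) ltNge ler_distD.
Qed.

End MeanValue.
(** * Calculus of smooth matrix-valued functions *)

Section MatrixCalculus.
Variables (R : realType) (n : nat).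
Implicit Types (V W : set 'rV[R]_n) (x : 'rV[R]_n).

Definition partial_mx p q (i : 'I_n) (F : 'rV[R]_n -> 'M[R]_(p, q)) x : 'M[R]_(p, q) :=
  \matrix_(a, b) partial i (fun y => F y a b) x.

Lemma partial_mx_ext p q i (F H : 'rV[R]_n -> 'M[R]_(p, q)) V x : open V -> V x ->
  (forall y, V y -> F y = H y) -> partial_mx i F x = partial_mx i H x.
Proof.
move=> oV Vx FH; apply/matrixP => a b; rewrite !mxE.
by apply: (partial_ext _ oV Vx) => y /FH ->.
Qed.

Lemma smooth_mx_ext p q V (F H : 'rV[R]_n -> 'M[R]_(p, q)) : open V ->
  (forall y, V y -> F y = H y) -> smooth_mx V F -> smooth_mx V H.
Proof.
by move=> oV FH sF a b; apply: (smooth_ext oV _ (sF a b)) => y /FH ->.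
Qed.

Lemma smooth_mx_sub p q V W (F : 'rV[R]_n -> 'M[R]_(p, q)) : W `<=` V ->
  smooth_mx V F -> smooth_mx W F.
Proof. by move=> WV sF a b; apply: (smooth_sub WV). Qed.

Lemma partial_mx_cst p q i (A : 'M[R]_(p, q)) x : partial_mx i (fun=> A) x = 0.
Proof. by apply/matrixP => a b; rewrite !mxE partial_cst. Qed.

Lemma smooth_partial_mx p q V i (F : 'rV[R]_n -> 'M[R]_(p, q)) :
  smooth_mx V F -> smooth_mx V (partial_mx i F).
Proof.
move=> sF a b; rewrite (_ : (fun _ => _) = partial i (fun y => F y a b)).
  exact: smooth_partial.
by apply/funext => y; rewrite mxE.
Qed.

Lemma partial_mxD p q V i (F H : 'rV[R]_n -> 'M[R]_(p, q)) x : V x ->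
  smooth_mx V F -> smooth_mx V H ->
  partial_mx i (fun y => F y + H y) x = partial_mx i F x + partial_mx i H x.
Proof.
move=> Vx sF sH; apply/matrixP => a b; rewrite !mxE -partialD; last 2 first.
- exact: smooth_derivable (sF a b) Vx.
- exact: smooth_derivable (sH a b) Vx.
by congr (partial i _ x); apply/funext => y; rewrite mxE.
Qed.

Lemma smooth_mxD p q V (F H : 'rV[R]_n -> 'M[R]_(p, q)) : open V ->
  smooth_mx V F -> smooth_mx V H -> smooth_mx V (fun y => F y + H y).
Proof.
move=> oV sF sH a b; apply: (smooth_ext oV _ (smoothD oV (sF a b) (sH a b))) => y _.
by rewrite mxE.
Qed.

Lemma partial_mxM p q r V i (F : 'rV[R]_n -> 'M[R]_(p, q)) (H : 'rV[R]_n -> 'M[R]_(q, r)) x :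
  open V -> V x -> smooth_mx V F -> smooth_mx V H ->
  partial_mx i (fun y => F y *m H y) x =
  partial_mx i F x *m H x + F x *m partial_mx i H x.
Proof.
move=> oV Vx sF sH; apply/matrixP => a b; rewrite !mxE.
rewrite (_ : (fun _ => _) = fun y => \sum_c F y a c * H y c b); last first.
  by apply/funext => y; rewrite mxE.
rewrite (partial_sum _ oV Vx); last by move=> c; apply: smoothM.
rewrite -big_split; apply: eq_bigr => c _; rewrite !mxE partialM //.
  exact: smooth_derivable (sF a c) Vx.
exact: smooth_derivable (sH c b) Vx.
Qed.

Lemma smooth_mxM p q r V (F : 'rV[R]_n -> 'M[R]_(p, q)) (H : 'rV[R]_n -> 'M[R]_(q, r)) :
  open V -> smooth_mx V F -> smooth_mx V H -> smooth_mx V (fun y => F y *m H y).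
Proof.
move=> oV sF sH a b.
apply: (@smooth_ext _ _ _ (fun y => \sum_c F y a c * H y c b)) => //.
  by move=> y _; rewrite mxE.
by apply: smooth_sum => // c; apply: smoothM.
Qed.

(** Transposition, rows, Clifford multiplication and the spin representation are
    linear maps of matrices; expanding them in coordinates reduces their
    smoothness and their derivatives to those of sums and products. *)
Lemma linear_coord p q r s (L : {linear 'M[R]_(p, q) -> 'M[R]_(r, s)}) A a b :
  L A a b = \sum_(k : 'I_p * 'I_q) A k.1 k.2 * L (delta_mx k.1 k.2) a b.
Proof.
rewrite {1}(matrix_sum_delta A) pair_bigA linear_sum summxE /=.
by apply: eq_bigr => k _; rewrite linearZ mxE.
Qed.

Lemma smooth_mx_linear p q r s (L : {linear 'M[R]_(p, q) -> 'M[R]_(r, s)}) V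
    (F : 'rV[R]_n -> 'M[R]_(p, q)) :
  open V -> smooth_mx V F -> smooth_mx V (fun y => L (F y)).
Proof.
move=> oV sF a b.
apply: (@smooth_ext _ _ _ (fun y =>
  \sum_(k : 'I_p * 'I_q) F y k.1 k.2 * L (delta_mx k.1 k.2) a b)) => //.
  by move=> y _; rewrite -linear_coord.
by apply: smooth_sum => // c; apply: smoothM => //; exact: smooth_cst.
Qed.

Lemma partial_mx_linear p q r s (L : {linear 'M[R]_(p, q) -> 'M[R]_(r, s)}) V i
    (F : 'rV[R]_n -> 'M[R]_(p, q)) x :
  open V -> V x -> smooth_mx V F ->
  partial_mx i (fun y => L (F y)) x = L (partial_mx i F x).
Proof.
move=> oV Vx sF; apply/matrixP => a b; rewrite !mxE linear_coord.
rewrite (_ : (fun _ => _) = fun y =>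
  \sum_(k : 'I_p * 'I_q) F y k.1 k.2 * L (delta_mx k.1 k.2) a b); last first.
  by apply/funext => y; rewrite linear_coord.
rewrite (partial_sum _ oV Vx); last by move=> c; apply: smoothM => //; exact: smooth_cst.
apply: eq_bigr => k _; rewrite partialM ?partial_cst ?mulr0 ?addr0 ?mxE //.
exact: smooth_derivable (sF _ _) Vx.
Qed.

Lemma partial_mxC p q V i j (F : 'rV[R]_n -> 'M[R]_(p, q)) x : open V -> V x ->
  smooth_mx V F -> partial_mx i (partial_mx j F) x = partial_mx j (partial_mx i F) x.
Proof.
move=> oV Vx sF.
apply/matrixP => a b.
rewrite [LHS]mxE.
rewrite [RHS]mxE.
have E k : (fun y => partial_mx k F y a b) = partial k (fun y => F y a b).
  by apply/funext => y; rewrite mxE.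
rewrite (E i).
rewrite (E j).
exact: partialC oV Vx (sF a b 2%N).
Qed.

End MatrixCalculus.
(** * The Levi-Civita connection in matrix form *)

Section LeviCivita.
Variables (R : realType) (n : nat) (G : 'rV[R]_n -> 'M[R]_n).
Implicit Types (V : set 'rV[R]_n) (x : 'rV[R]_n).

(** Row [j] holds the coordinates of the covariant derivative of the [j]-th
    coordinate field along the [i]-th axis, so that the covariant derivative of a
    field [W] is the partial derivative plus [W *m conn i]. *)
Definition conn (i : 'I_n) x : 'M[R]_n := \matrix_(j, k) christoffel G k i j x.

(** Christoffel symbols of the first kind. *)
Definition lower_conn (i : 'I_n) x : 'M[R]_n := \matrix_(j, l)
  (2^-1 * (partial i (fun y => G y j l) x + partial j (fun y => G y i l) x
           - partial l (fun y => G y i j) x)).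

(** Row [k] is the curvature R(d_i, d_j) applied to the [k]-th coordinate field. *)
Definition curvature_mx (i j : 'I_n) x : 'M[R]_n :=
  partial_mx i (conn j) x - partial_mx j (conn i) x
  + conn j x *m conn i x - conn i x *m conn j x.

Lemma covE i W x : cov G i W x = partial_mx i W x + W x *m conn i x.
Proof.
apply/rowP => k; rewrite !mxE; congr (_ + _).
by apply: eq_bigr => j _; rewrite !mxE mulrC.
Qed.

Lemma riemannE i j k x : riemann G i j k x = row k (curvature_mx i j x).
Proof.
have covk l : cov G l (fun=> basis_vec R k) = fun y => row k (conn l y).
  by apply/funext => y; rewrite covE partial_mx_cst add0r -rowE.
have rowk l m : partial_mx l (fun y => row k (conn m y)) x = row k (partial_mx l (conn m) x).
  apply/rowP => a; rewrite !mxE; congr (partial l _ x).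
  by apply/funext => y; rewrite mxE.
rewrite /riemann !covk !covE !rowk -!row_mul.
rewrite /curvature_mx.
move: (partial_mx i _ x) (partial_mx j _ x) (conn j x *m _) (conn i x *m _) => A B C D.
by apply/rowP => m; rewrite !mxE opprD addrACA addrA.
Qed.

Lemma ricciE x j k : ricci G x j k = \sum_i curvature_mx i j x k i.
Proof. by rewrite mxE; apply: eq_bigr => i _; rewrite riemannE mxE. Qed.

Lemma conn_lower i x : conn i x = lower_conn i x *m (invmx (G x))^T.
Proof.
apply/matrixP => j k; rewrite !mxE /christoffel mulr_sumr.
by apply: eq_bigr => l _; rewrite !mxE -[RHS]mulrA; congr (_ * _); rewrite mulrC.
Qed.

(** The Levi-Civita connection is metric: multiplying by [G] lowers the index, and
    in the sum of the symbols of the first kind with their transpose only the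
    derivative along the [i]-th axis survives. *)
Lemma conn_metric i V x : open V -> V x -> G x \in unitmx ->
  (forall y, V y -> (G y)^T = G y) ->
  conn i x *m G x + (conn i x *m G x)^T = partial_mx i G x.
Proof.
move=> oV Vx uG symG; rewrite conn_lower trmx_inv (symG _ Vx) mulmxKV //.
apply/matrixP => j l; rewrite !mxE.
have -> : partial i (fun y => G y l j) x = partial i (fun y => G y j l) x.
  by apply: (partial_ext _ oV Vx) => y /symG e; rewrite -[in LHS]e mxE.
by move: (partial i _ x) (partial j _ x) (partial l _ x) => a b c; lra.
Qed.

Lemma smooth_conn V i : open V -> smooth_mx V G -> smooth_mx V (fun x => invmx (G x)) ->
  smooth_mx V (conn i).
Proof.
move=> oV sG sI j k; rewrite (_ : (fun _ => _) = christoffel G k i j); last first.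
  by apply/funext => y; rewrite mxE.
apply: smoothM => //; first exact: smooth_cst.
apply: smooth_sum => // l; apply: smoothM => //.
apply: smoothD => //; last by apply: smoothN => //; apply: smooth_partial; exact: sG.
by apply: smoothD => //; apply: smooth_partial; exact: sG.
Qed.

Lemma smooth_ricci V : open V -> smooth_mx V G -> smooth_mx V (fun x => invmx (G x)) ->
  smooth_mx V (ricci G).
Proof.
move=> oV sG sI j k.
apply: (@smooth_ext _ _ _ (fun x => \sum_i curvature_mx i j x k i)) => //.
  by move=> y _; rewrite ricciE.
have sC i := smooth_conn i oV sG sI.
apply: smooth_sum => // i.
suff : smooth_mx V (curvature_mx i j) by exact.
have sN (F : 'rV[R]_n -> 'M[R]_n) : smooth_mx V F -> smooth_mx V (fun y => - F y).
  exact: (smooth_mx_linear (-%R : {linear 'M[R]_n -> 'M[R]_n}) oV).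
apply: smooth_mxD => //; last by apply: sN; exact: smooth_mxM.
apply: smooth_mxD => //; last exact: smooth_mxM.
apply: smooth_mxD => //; last by apply: sN; exact: smooth_partial_mx.
exact: smooth_partial_mx.
Qed.

End LeviCivita.

(** * Clifford algebra *)

Section CliffordAlgebra.
Variables (R : realFieldType) (n K : nat) (g : 'I_n -> 'M[R]_K).

Definition cliff (v : 'rV[R]_n) : 'M[R]_K := \sum_j v 0 j *: g j.

(** The spin representation of so(n); the factor 1/4 makes the commutator with a
    vector [v] the vector [v *m A] ([comm_spin_cliff]). *)
Definition spin_rep (A : 'M[R]_n) : 'M[R]_K :=
  4^-1 *: \sum_j \sum_k A j k *: (g j *m g k).

Fact cliff_is_linear : linear cliff.
Proof.
move=> a u v; rewrite /cliff scaler_sumr -big_split; apply: eq_bigr => j _.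
by rewrite !mxE scalerDl scalerA.
Qed.
HB.instance Definition _ := GRing.isLinear.Build R _ _ _ cliff cliff_is_linear.

Fact spin_rep_is_linear : linear spin_rep.
Proof.
move=> a A B; rewrite /spin_rep scalerA mulrC -scalerA -scalerDr; congr (_ *: _).
rewrite scaler_sumr -big_split; apply: eq_bigr => j _.
rewrite scaler_sumr -big_split; apply: eq_bigr => k _.
by rewrite !mxE scalerDl scalerA.
Qed.
HB.instance Definition _ := GRing.isLinear.Build R _ _ _ spin_rep spin_rep_is_linear.

Hypothesis gP : forall j k, g j *m g k + g k *m g j = (- ((j == k)%:R *+ 2))%:M.

Lemma comm_gen2 j k m : g j *m g k *m g m - g m *m (g j *m g k) =
  ((j == m)%:R *+ 2) *: g k - ((k == m)%:R *+ 2) *: g j.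
Proof.
have E1 : g k *m g m = (- ((k == m)%:R *+ 2))%:M - g m *m g k by rewrite -gP addrK.
have E2 : g m *m g j = (- ((j == m)%:R *+ 2))%:M - g j *m g m.
  by rewrite -(gP j m) addrC addKr .
rewrite -mulmxA E1 mulmxA E2 mulmxBr mulmxBl mulmxA mul_mx_scalar mul_scalar_mx.
by rewrite !scaleNr opprB opprK addrA subrK addrC.
Qed.

(** Moving [g m] through [g j *m g k] costs only vectors, and by antisymmetry the
    two resulting sums coincide, which the factor 1/4 compensates. *)
Lemma comm_spin_gen (A : 'M[R]_n) m : A^T = - A ->
  spin_rep A *m g m - g m *m spin_rep A = cliff (row m A).
Proof.
move=> antiA; have anti j k : A j k = - A k j.
  by have /matrixP/(_ k j) := antiA; rewrite !mxE.
rewrite /spin_rep -scalemxAl -scalemxAr -scalerBr mulmx_suml mulmx_sumr -sumrB.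
under eq_bigr => j _.
  rewrite mulmx_suml mulmx_sumr -sumrB.
  under eq_bigr => k _.
    rewrite -scalemxAl -scalemxAr -scalerBr comm_gen2 scalerBr !scalerA. over.
  rewrite sumrB. over.
rewrite sumrB.
have -> : \sum_j \sum_k (A j k * ((j == m)%:R *+ 2)) *: g k = \sum_k (A m k *+ 2) *: g k.
  rewrite (bigD1 m) //= [X in _ + X]big1 ?addr0.
    by apply: eq_bigr => k _; rewrite eqxx mulrnAr mulr1.
  by move=> j /negPf ->; apply: big1 => k _; rewrite mul0rn mulr0 scale0r.
have -> : \sum_j \sum_k (A j k * ((k == m)%:R *+ 2)) *: g j = - \sum_j (A m j *+ 2) *: g j.
  rewrite -sumrN; apply: eq_bigr => j _.
  rewrite (bigD1 m) //= [X in _ + X]big1 ?addr0; last first.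
    by move=> k /negPf ->; rewrite mul0rn mulr0 scale0r.
  by rewrite eqxx mulrnAr mulr1 anti mulNrn scaleNr.
rewrite opprK -big_split scaler_sumr; apply: eq_bigr => k _.
rewrite /= -scalerDl scalerA mxE; congr (_ *: _); lra.
Qed.

(** This is what makes the spin connection compatible with Clifford
    multiplication. *)
Lemma comm_spin_cliff (A : 'M[R]_n) v : A^T = - A ->
  spin_rep A *m cliff v - cliff v *m spin_rep A = cliff (v *m A).
Proof.
move=> antiA; rewrite {1 2}/cliff mulmx_sumr mulmx_suml -sumrB.
under eq_bigr => m _ do rewrite -scalemxAl -scalemxAr -scalerBr comm_spin_gen //.
rewrite mulmx_sum_row linear_sum; apply: eq_bigr => m _.
by rewrite linearZ.
Qed.

(** A commutator is a derivation, so this follows from its values on generators.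
    The order is reversed because the matrices act on row vectors from the
    right. *)
Lemma comm_spin_spin (A B : 'M[R]_n) : A^T = - A ->
  spin_rep A *m spin_rep B - spin_rep B *m spin_rep A = spin_rep (B *m A - A *m B).
Proof.
move=> antiA.
have : forall m, spin_rep A *m g m - g m *m spin_rep A = cliff (row m A).
  by move=> m; exact: comm_spin_gen.
move: (spin_rep A) => S SP.
rewrite [spin_rep B]/spin_rep -scalemxAl -scalemxAr -scalerBr mulmx_suml mulmx_sumr -sumrB.
rewrite [in RHS]/spin_rep; congr (_ *: _).
have der j k : S *m (g j *m g k) - (g j *m g k) *m S =
    \sum_m A j m *: (g m *m g k) + \sum_m A k m *: (g j *m g m).
  have -> : S *m (g j *m g k) - (g j *m g k) *m S =
      (S *m g j - g j *m S) *m g k +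
      g j *m (S *m g k - g k *m S).
    by rewrite mulmxBl mulmxBr !mulmxA addrA subrK.
  rewrite !SP /cliff mulmx_suml mulmx_sumr; congr (_ + _).
    by apply: eq_bigr => m _; rewrite mxE scalemxAl.
  by apply: eq_bigr => m _; rewrite mxE -scalemxAr.
under eq_bigr => j _.
  rewrite mulmx_suml mulmx_sumr -sumrB.
  under eq_bigr => k _.
    rewrite -scalemxAl -scalemxAr -scalerBr der scalerDr !scaler_sumr. over.
  rewrite big_split /=. over.
rewrite big_split /=.
have -> : \sum_j \sum_k \sum_m B j k *: (A j m *: (g m *m g k)) =
          \sum_m \sum_k (- (A *m B) m k) *: (g m *m g k).
  under eq_bigr => j _ do rewrite exchange_big.
  rewrite exchange_big; apply: eq_bigr => m _.
  rewrite exchange_big; apply: eq_bigr => k _.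
  rewrite mxE -sumrN scaler_suml; apply: eq_bigr => j _.
  have /matrixP/(_ j m) := antiA; rewrite !mxE => ->.
  by rewrite scalerA mulNr opprK mulrC.
have -> : \sum_j \sum_k \sum_m B j k *: (A k m *: (g j *m g m)) =
          \sum_j \sum_m (B *m A) j m *: (g j *m g m).
  apply: eq_bigr => j _; rewrite exchange_big; apply: eq_bigr => m _.
  by rewrite mxE scaler_suml; apply: eq_bigr => k _; rewrite scalerA.
rewrite addrC -big_split; apply: eq_bigr => j _.
rewrite -big_split; apply: eq_bigr => k _.
by rewrite /= -scalerDl !mxE.
Qed.

(** Orthogonal vectors anticommute, and the square of [u] is minus its squared
    length. *)
Lemma cliff_anticomm u v : cliff u *m cliff v + cliff v *m cliff u = (- (u *m v^T) 0 0 *+ 2)%:M.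
Proof.
have -> : (u *m v^T) 0 0 = \sum_j u 0 j * v 0 j.
  by rewrite mxE; apply: eq_bigr => j _; rewrite mxE.
have gen j : cliff u *m g j + g j *m cliff u = (- u 0 j *+ 2)%:M.
  rewrite /cliff mulmx_suml mulmx_sumr -big_split (bigD1 j) //= [X in _ + X]big1.
    rewrite -scalemxAl -scalemxAr -scalerDr gP eqxx addr0.
    by rewrite scale_scalar_mx mulrN mulNrn mulrnAr mulr1.
  move=> i /negPf ij; rewrite -scalemxAl -scalemxAr -scalerDr gP ij.
  by rewrite mul0rn oppr0 scale_scalar_mx mulr0 raddf0.
move: (cliff u) gen => S gen; rewrite /cliff mulmx_suml mulmx_sumr -big_split -sumrN -sumrMnl raddf_sum.
apply: eq_bigr => j _ /=.
rewrite -scalemxAl -scalemxAr -scalerDr gen scale_scalar_mx; congr (_%:M).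
by rewrite mulrnAr mulrN mulrC.
Qed.

End CliffordAlgebra.
(** * The integrability condition *)

Section Integrability.
Variables (R : realType) (n K : nat) (g : 'I_n -> 'M[R]_K).
Hypothesis gP : forall j k, g j *m g k + g k *m g j = (- ((j == k)%:R *+ 2))%:M.
Variables (G E : 'rV[R]_n -> 'M[R]_n) (V : set 'rV[R]_n).
Hypotheses (oV : open V) (sG : smooth_mx V G) (sE : smooth_mx V E).
Hypothesis symG : forall x, V x -> (G x)^T = G x.
Hypothesis orthE : forall x, V x -> E x *m G x *m (E x)^T = 1%:M.
Implicit Type x : 'rV[R]_n.

(** The coefficients g(nabla_i e_j, e_k) for the frame given by the rows of [E]. *)
Definition frame_conn (i : 'I_n) x : 'M[R]_n :=
  (partial_mx i E x + E x *m conn G i x) *m G x *m (E x)^T.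

(** The components of Ric(d_i) in the frame. *)
Definition frame_ricci (i : 'I_n) x : 'rV[R]_n := row i (ricci G x) *m (E x)^T.

(** The coordinates of Ric(d_i). *)
Definition ricci_field (i : 'I_n) x : 'rV[R]_n := row i (ricci G x) *m invmx (G x).

Lemma frame_mulVmx x : V x -> G x *m (E x)^T *m E x = 1%:M.
Proof. by move=> /orthE; rewrite -mulmxA => /mulmx1C. Qed.

Lemma metric_unit x : V x -> G x \in unitmx.
Proof. by move=> /frame_mulVmx; rewrite -mulmxA => /mulmx1_unit[]. Qed.

(** The inverse metric is polynomial in an orthonormal frame, hence smooth. *)
Lemma invmx_metric x : V x -> invmx (G x) = (E x)^T *m E x.
Proof.
move=> Vx; rewrite -[RHS](mulKmx (metric_unit Vx)) (mulmxA (G x)).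
by rewrite frame_mulVmx // mulmx1.
Qed.

Let sET : smooth_mx V (fun x => (E x)^T).
Proof. exact: (smooth_mx_linear (@trmx R n n : {linear _ -> _}) oV). Qed.

Lemma smooth_invmx_metric : smooth_mx V (fun x => invmx (G x)).
Proof.
apply: (@smooth_mx_ext _ _ _ _ _ (fun x => (E x)^T *m E x)) => //.
  by move=> x /invmx_metric.
exact: smooth_mxM.
Qed.

Lemma smooth_frame_conn i : smooth_mx V (frame_conn i).
Proof.
apply: smooth_mxM => //; apply: smooth_mxM => //; apply: smooth_mxD => //.
  exact: smooth_partial_mx.
apply: smooth_mxM => //; apply: smooth_conn => //; exact: smooth_invmx_metric.
Qed.

Lemma smooth_frame_ricci i : smooth_mx V (frame_ricci i).
Proof.
apply: smooth_mxM => //.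
apply: (smooth_mx_linear (row i : {linear 'M[R]_n -> 'rV[R]_n}) oV).
apply: smooth_ricci => //; exact: smooth_invmx_metric.
Qed.

Lemma frame_connE i x : V x -> frame_conn i x *m E x = partial_mx i E x + E x *m conn G i x.
Proof.
by move=> Vx; rewrite /frame_conn -!mulmxA (mulmxA (G x)) frame_mulVmx // mulmx1.
Qed.

Lemma frame_ricciE i x : V x -> frame_ricci i x *m E x = ricci_field i x.
Proof. by move=> Vx; rewrite /frame_ricci /ricci_field invmx_metric // mulmxA. Qed.

Lemma frame_unit x : V x -> E x \in unitmx.
Proof. by move=> /frame_mulVmx/mulmx1_unit[]. Qed.

(** This is the derivative of the orthonormality relation; [conn_metric] accounts
    for the derivative of [G]. *)
Lemma frame_conn_anti i x : V x -> (frame_conn i x)^T = - frame_conn i x.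
Proof.
move=> Vx; apply/eqP; rewrite -addr_eq0; apply/eqP.
have sEG : smooth_mx V (fun y => E y *m G y) by exact: smooth_mxM.
have : partial_mx i (fun y => E y *m G y *m (E y)^T) x = 0.
  rewrite (partial_mx_ext i oV Vx (H := fun=> 1%:M)) ?partial_mx_cst //.
rewrite (partial_mxM i oV Vx sEG sET) (partial_mxM i oV Vx sE sG).
rewrite (partial_mx_linear (@trmx R n n : {linear _ -> _}) i oV Vx sE) /=.
rewrite -(conn_metric i oV Vx (metric_unit Vx) symG) /frame_conn.
move: (partial_mx i E x) (E x) (conn G i x) => D e c.
rewrite !trmx_mul trmxK (_ : (D + e *m c)^T = D^T + c^T *m e^T); last first.
  by rewrite -trmx_mul; apply/matrixP => a b; rewrite !mxE.
rewrite !(symG Vx) => <-.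
rewrite !(mulmxDl, mulmxDr) -!mulmxA.
move: (D *m _) (e *m (c *m _)) (e *m (G x *m (c^T *m _))) (e *m (G x *m D^T)) => a b d f.
by apply/matrixP => k l; rewrite !mxE; lra.
Qed.

(** The connection matrices of the frame are the gauge transforms of those of the
    coordinates ([frame_connE]), so their curvatures are conjugate by [E]: this is
    the derivative of [frame_connE], antisymmetrized to cancel the second
    derivatives of [E]. *)
Lemma frame_curvature i j x : V x ->
  (partial_mx i (frame_conn j) x - partial_mx j (frame_conn i) x
   + frame_conn j x *m frame_conn i x - frame_conn i x *m frame_conn j x) *m E x
  = E x *m curvature_mx G i j x.
Proof.
move=> Vx.
have sc k : smooth_mx V (conn G k) := smooth_conn k oV sG smooth_invmx_metric.
have key k l : partial_mx k (frame_conn l) x *m E x =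
    partial_mx k (partial_mx l E) x + E x *m partial_mx k (conn G l) x
    + partial_mx k E x *m conn G l x - frame_conn l x *m partial_mx k E x.
  have := partial_mx_ext k oV Vx (frame_connE l).
  rewrite (partial_mxM k oV Vx (smooth_frame_conn l) sE).
  rewrite (partial_mxD (V := V) k Vx); last 2 first.
  - exact: smooth_partial_mx.
  - exact: smooth_mxM.
  rewrite (partial_mxM k oV Vx sE (sc l)).
  move: (_ *m E x) (_ *m partial_mx k E x) (partial_mx k (partial_mx l E) x)
    (partial_mx k E x *m _) (E x *m _) => a1 a2 a3 a4 a5 /matrixP h.
  by apply/matrixP => a b; have := h a b; rewrite !mxE; lra.
have := key j i; have := key i j; rewrite (partial_mxC i j oV Vx sE).
have := frame_connE i Vx; have := frame_connE j Vx; rewrite /curvature_mx.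
move: (partial_mx i (frame_conn j) x) (partial_mx j (frame_conn i) x)
  (frame_conn i x) (frame_conn j x) (partial_mx j (partial_mx i E) x)
  (partial_mx i (conn G j) x) (partial_mx j (conn G i) x) (partial_mx i E x)
  (partial_mx j E x) (conn G i x) (conn G j x) (E x).
move=> Dwj Dwi wi wj DDe Dcj Dci Die Dje ci cj e ej ei kij kji.
rewrite !mulmxDl !mulNmx kij kji -(mulmxA wj wi) -(mulmxA wi wj) ei ej.
rewrite !mulmxDr !mulmxN (mulmxA wj) (mulmxA wi) ei ej !mulmxDl ?mulmxN !mulmxA.
move: (wj *m Die) (wi *m Dje) (e *m cj *m ci) (e *m ci *m cj) (e *m Dcj) (e *m Dci)
  (Die *m cj) (Dje *m ci) => a1 a2 a3 a4 a5 a6 a7 a8.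
apply/matrixP => a b; rewrite !mxE.
by move: (DDe a b) (a1 a b) (a2 a b) (a3 a b) (a4 a b) (a5 a b) (a6 a b) (a7 a b) (a8 a b)
  => d b1 b2 b3 b4 b5 b6 b7 b8; ring.
Qed.

(** Differentiating [frame_ricciE] turns the covariant derivative in the frame into
    the one in coordinates. *)
Lemma frame_ricci_cov i j x : V x ->
  (partial_mx i (frame_ricci j) x + frame_ricci j x *m frame_conn i x) *m E x
  = cov G i (ricci_field j) x.
Proof.
move=> Vx; rewrite covE -(partial_mx_ext i oV Vx (frame_ricciE j)) -frame_ricciE //.
rewrite (partial_mxM i oV Vx (smooth_frame_ricci j) sE) mulmxDl.
rewrite -(mulmxA (frame_ricci j x) (frame_conn i x)) frame_connE //.
by rewrite mulmxDr (mulmxA (frame_ricci j x)) addrA.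
Qed.

Section KillingSpinor.
Variables (q : nat) (Psi : 'rV[R]_n -> 'M[R]_(K, q)) (mu : R).
Hypotheses (mu0 : mu != 0) (sPsi : smooth_mx V Psi).

(** The coefficients of the Ricci Killing equation, solved for the partial
    derivatives of the spinor. *)
Definition killing_mx i x : 'M[R]_K :=
  mu *: cliff g (frame_ricci i x) - spin_rep g (frame_conn i x).

Hypothesis killingP : forall i x, V x -> partial_mx i Psi x = killing_mx i x *m Psi x.

Lemma smooth_killing_mx i : smooth_mx V (killing_mx i).
Proof.
have sC := smooth_mx_linear (cliff g : {linear _ -> _}) oV (smooth_frame_ricci i).
have sS := smooth_mx_linear (spin_rep g : {linear _ -> _}) oV (smooth_frame_conn i).
apply: (smooth_mxD oV (F := fun x => mu *: cliff g (frame_ricci i x))).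
  exact: (smooth_mx_linear ( *:%R mu : {linear 'M[R]_K -> 'M[R]_K}) oV sC).
exact: (smooth_mx_linear (-%R : {linear 'M[R]_K -> 'M[R]_K}) oV sS).
Qed.

Lemma partial_killing_mx i j x : V x -> partial_mx i (killing_mx j) x =
  mu *: cliff g (partial_mx i (frame_ricci j) x) - spin_rep g (partial_mx i (frame_conn j) x).
Proof.
move=> Vx.
have sC := smooth_mx_linear (cliff g : {linear _ -> _}) oV (smooth_frame_ricci j).
have sS := smooth_mx_linear (spin_rep g : {linear _ -> _}) oV (smooth_frame_conn j).
rewrite (partial_mxD (V := V) i Vx (F := fun x => mu *: cliff g (frame_ricci j x))
  (H := fun x => - spin_rep g (frame_conn j x))).
- rewrite (partial_mx_linear ( *:%R mu : {linear 'M[R]_K -> 'M[R]_K}) i oV Vx sC).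
  rewrite (partial_mx_linear (-%R : {linear 'M[R]_K -> 'M[R]_K}) i oV Vx sS).
  rewrite (partial_mx_linear (cliff g : {linear _ -> _}) i oV Vx (smooth_frame_ricci j)).
  by rewrite (partial_mx_linear (spin_rep g : {linear _ -> _}) i oV Vx (smooth_frame_conn j)).
- exact: (smooth_mx_linear ( *:%R mu : {linear 'M[R]_K -> 'M[R]_K}) oV sC).
- exact: (smooth_mx_linear (-%R : {linear 'M[R]_K -> 'M[R]_K}) oV sS).
Qed.

(** Commuting the second derivatives of [Psi] shows that it is killed by
    d_i B_j - d_j B_i + [B_j, B_i], with B the coefficients [killing_mx]. Under
    the hypotheses the derivatives of the connection and of the Ricci components
    are given by products, and all terms cancel but the commutator of the
    Clifford factors. *)
Lemma killing_integrability i j x : V x -> curvature_mx G i j x = 0 ->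
  cov G i (ricci_field j) x = 0 -> cov G j (ricci_field i) x = 0 ->
  (cliff g (frame_ricci i x) *m cliff g (frame_ricci j x)
   - cliff g (frame_ricci j x) *m cliff g (frame_ricci i x)) *m Psi x = 0.
Proof.
move=> Vx flat parj pari.
have inj0 p (A : 'M[R]_(p, n)) : A *m E x = 0 -> A = 0.
  by move=> h; rewrite -(mulmxK (frame_unit Vx) A) h mul0mx.
have dw : partial_mx i (frame_conn j) x - partial_mx j (frame_conn i) x =
    frame_conn i x *m frame_conn j x - frame_conn j x *m frame_conn i x.
  have := frame_curvature i j Vx; rewrite flat (mulmx0 _ (E x)) => /inj0.
  move: (frame_conn i x) (frame_conn j x) => wi wj.
  move: (wj *m wi) (wi *m wj) => a b /eqP.
  by rewrite subr_eq add0r => /eqP <-; rewrite addrK.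
have dc k l : cov G k (ricci_field l) x = 0 ->
    partial_mx k (frame_ricci l) x = - (frame_ricci l x *m frame_conn k x).
  rewrite -frame_ricci_cov // => /inj0/eqP.
  by rewrite addr_eq0 => /eqP.
have DD k l : partial_mx k (partial_mx l Psi) x =
    (partial_mx k (killing_mx l) x + killing_mx l x *m killing_mx k x) *m Psi x.
  rewrite (partial_mx_ext k oV Vx (killingP l)).
  rewrite (partial_mxM k oV Vx (smooth_killing_mx l) sPsi) (killingP k Vx).
  by rewrite (mulmxDl (partial_mx k (killing_mx l) x)) (mulmxA (killing_mx l x)).
have := partial_mxC i j oV Vx sPsi; rewrite !DD => /eqP; rewrite -subr_eq0 -mulmxBl.
suff -> : partial_mx i (killing_mx j) x + killing_mx j x *m killing_mx i x
    - (partial_mx j (killing_mx i) x + killing_mx i x *m killing_mx j x) =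
    - (mu ^+ 2) *: (cliff g (frame_ricci i x) *m cliff g (frame_ricci j x)
   - cliff g (frame_ricci j x) *m cliff g (frame_ricci i x)).
  by rewrite -scalemxAl scaler_eq0 oppr_eq0 expf_eq0 (negPf mu0) /= => /eqP.
rewrite !partial_killing_mx // (dc _ _ parj) (dc _ _ pari).
have h1 : spin_rep g (partial_mx i (frame_conn j) x) - spin_rep g (partial_mx j (frame_conn i) x)
    = spin_rep g (frame_conn j x) *m spin_rep g (frame_conn i x)
      - spin_rep g (frame_conn i x) *m spin_rep g (frame_conn j x).
  by rewrite (comm_spin_spin gP _ (frame_conn_anti j Vx)) -dw [RHS]linearB /=.
have h2 k l : cliff g (- (frame_ricci k x *m frame_conn l x)) =
    cliff g (frame_ricci k x) *m spin_rep g (frame_conn l x)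
    - spin_rep g (frame_conn l x) *m cliff g (frame_ricci k x).
  rewrite [LHS]linearN /= -(comm_spin_cliff gP (frame_ricci k x) (frame_conn_anti l Vx)).
  exact: opprB.
have := h2 i j; have := h2 j i; have := h1; rewrite /killing_mx.
move: (partial_mx i (frame_conn j) x) (partial_mx j (frame_conn i) x).
move: (frame_conn i x) (frame_conn j x) (frame_ricci i x) (frame_ricci j x).
move=> wi wj ci cj Dj Di {}h1 -> ->; move: h1.
move: (spin_rep g Dj) (spin_rep g Di) (spin_rep g wi) (spin_rep g wj).
move: (cliff g ci) (cliff g cj) => {Di Dj wi wj ci cj} Ci Cj Di Dj Si Sj.
move=> /eqP; rewrite subr_eq => /eqP ->.
rewrite !(mulmxBl, mulmxBr) -!scalemxAl -!scalemxAr.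
move: (Ci *m Cj) (Cj *m Ci) (Ci *m Sj) (Sj *m Ci) (Si *m Cj) (Cj *m Si) (Si *m Sj) (Sj *m Si).
move=> a1 a2 a3 a4 a5 a6 a7 a8; apply/matrixP => a b; rewrite !mxE.
move: (a1 a b) (a2 a b) (a3 a b) (a4 a b) (a5 a b) (a6 a b) (a7 a b) (a8 a b) (Dj a b).
move=> b1 b2 b3 b4 b5 b6 b7 b8 d; ring.
Qed.


(** Orthogonal vectors anticommute, so that twice the Clifford product of Ric(d_i)
    and Ric(d_j) kills [Psi], and a nonzero vector acts injectively because its
    square is a nonzero scalar. *)
Lemma killing_spinor_eq0 i j x : V x -> curvature_mx G i j x = 0 ->
  cov G i (ricci_field j) x = 0 -> cov G j (ricci_field i) x = 0 ->
  ricci_field i x *m G x *m (ricci_field j x)^T = 0 ->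
  row i (ricci G x) != 0 -> row j (ricci G x) != 0 -> Psi x = 0.
Proof.
move=> Vx flat parj pari orth ri rj.
have := killing_integrability Vx flat parj pari.
have cN k : row k (ricci G x) != 0 -> frame_ricci k x != 0.
  apply: contra_neq => c0; rewrite -(mulmxK (_ : (E x)^T \in unitmx) (row k _)).
    by rewrite -/(frame_ricci k x) c0 mul0mx.
  by rewrite unitmx_tr frame_unit.
have cc : frame_ricci i x *m (frame_ricci j x)^T = 0.
  have := orthE Vx; rewrite -orth -(frame_ricciE i Vx) -(frame_ricciE j Vx).
  move: (frame_ricci i x) (frame_ricci j x) (E x) (G x) => u v e h o.
  by rewrite trmx_mul mulmxA -(mulmxA u e h) -(mulmxA u (e *m h)) o mulmx1.
have inj u (A : 'M[R]_(K, q)) : u != 0 -> cliff g u *m A = 0 -> A = 0.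
  move=> u0 /(congr1 (mulmx (cliff g u))); rewrite mulmx0 mulmxA.
  have : cliff g u *m cliff g u = (- (u *m u^T) 0 0)%:M.
    have := cliff_anticomm gP u u; move: (cliff g u) ((u *m u^T) 0 0) => C r.
    move=> /matrixP h; apply/matrixP => a b; have := h a b; rewrite !mxE.
    by move: ((C *m C) a b) (a == b) => y [|]; rewrite ?mulr1n ?mulr0n; lra.
  move=> ->; rewrite mul_scalar_mx => /eqP; rewrite scaler_eq0 oppr_eq0 => /orP[/eqP uu|/eqP//].
  case/eqP: u0; apply/rowP => k; rewrite mxE; apply/eqP.
  have /eqP := uu; rewrite mxE psumr_eq0; last by move=> l _; rewrite mxE -expr2 sqr_ge0.
  by move=> /allP/(_ k (mem_index_enum _)); rewrite mxE -expr2 sqrf_eq0.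
have := cliff_anticomm gP (frame_ricci i x) (frame_ricci j x).
rewrite cc mxE oppr0 mul0rn raddf0 => /eqP; rewrite addr_eq0 => /eqP ->.
rewrite -opprD mulNmx => /eqP; rewrite oppr_eq0 -mulr2n => /eqP.
move: (inj _ (Psi x) (cN _ ri)) (inj _ (cliff g (frame_ricci i x) *m Psi x) (cN _ rj)).
move: (cliff g (frame_ricci i x)) (cliff g (frame_ricci j x)) => Ci Cj inji injj h.
apply: inji; apply: injj; rewrite mulmxA.
move: h; rewrite -scaler_nat -scalemxAl => /eqP; rewrite scaler_eq0 pnatr_eq0 /= => /eqP.
by [].
Qed.

End KillingSpinor.

End Integrability.
(** * Geometry of a Riemannian product *)

Section Locality.
Variables (R : realType) (n : nat) (G G' : 'rV[R]_n -> 'M[R]_n) (V : set 'rV[R]_n).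
Hypotheses (oV : open V) (GG : forall x, V x -> G x = G' x).
Implicit Type x : 'rV[R]_n.

Lemma conn_ext i x : V x -> conn G i x = conn G' i x.
Proof.
move=> Vx; have e a b k : partial k (fun y => G y a b) x = partial k (fun y => G' y a b) x.
  by apply: (partial_ext _ oV Vx) => y /GG ->.
apply/matrixP => j k; rewrite mxE [RHS]mxE /christoffel (GG Vx); congr (_ * _).
by apply: eq_bigr => l _; rewrite !e.
Qed.

Lemma curvature_mx_ext i j x : V x -> curvature_mx G i j x = curvature_mx G' i j x.
Proof.
move=> Vx.
have e1 := partial_mx_ext i oV Vx (conn_ext j).
have e2 := partial_mx_ext j oV Vx (conn_ext i).
have e3 := conn_ext i Vx; have e4 := conn_ext j Vx.
rewrite /curvature_mx.
by refine (f_equal2 _ (f_equal2 _ (f_equal2 _ e1 (f_equal _ e2)) (f_equal2 _ e4 e3))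
  (f_equal _ (f_equal2 _ e3 e4))).
Qed.

Lemma ricci_ext x : V x -> ricci G x = ricci G' x.
Proof.
move=> Vx; apply/matrixP => j k; rewrite [LHS]ricciE [RHS]ricciE.
by apply: eq_bigr => i _; rewrite (curvature_mx_ext i j Vx).
Qed.

Lemma ricci_field_ext i x : V x -> ricci_field G i x = ricci_field G' i x.
Proof. by move=> Vx; rewrite /ricci_field ricci_ext // GG. Qed.

Lemma cov_ricci_field_ext i j x : V x ->
  cov G i (ricci_field G j) x = cov G' i (ricci_field G' j) x.
Proof.
move=> Vx; rewrite !covE conn_ext // ricci_field_ext //.
by rewrite (partial_mx_ext i oV Vx (ricci_field_ext j)).
Qed.

End Locality.

Section Product.
Variables (R : realType) (n1 n2 : nat).
Variables (G1 : 'rV[R]_n1 -> 'M[R]_n1) (G2 : 'rV[R]_n2 -> 'M[R]_n2).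
Implicit Type x : 'rV[R]_(n1 + n2).

Definition prod_metric x : 'M[R]_(n1 + n2) :=
  block_mx (G1 (lsubmx x)) 0 0 (G2 (rsubmx x)).

Let lsub_l i : lsubmx (basis_vec R (lshift n2 i) : 'rV_(n1 + n2)) = basis_vec R i.
Proof. by apply/rowP => k; rewrite !mxE (inj_eq (@lshift_inj _ _)). Qed.

Let lsub_r i : lsubmx (basis_vec R (rshift n1 i) : 'rV_(n1 + n2)) = 0.
Proof. by apply/rowP => k; rewrite !mxE eq_lrshift andbF. Qed.

Let rsub_l i : rsubmx (basis_vec R (lshift n2 i) : 'rV_(n1 + n2)) = 0.
Proof. by apply/rowP => k; rewrite !mxE eq_rlshift andbF. Qed.

Let rsub_r i : rsubmx (basis_vec R (rshift n1 i) : 'rV_(n1 + n2)) = basis_vec R i.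
Proof. by apply/rowP => k; rewrite !mxE (inj_eq (@rshift_inj _ _)). Qed.

Let lsubL (h : R) (v x : 'rV[R]_(n1 + n2)) :
  lsubmx (h *: v + x) = h *: lsubmx v + lsubmx x.
Proof. by apply/rowP => k; rewrite !mxE. Qed.

Let rsubL (h : R) (v x : 'rV[R]_(n1 + n2)) :
  rsubmx (h *: v + x) = h *: rsubmx v + rsubmx x.
Proof. by apply/rowP => k; rewrite !mxE. Qed.

Lemma partial_lsub_l i (f : 'rV[R]_n1 -> R) x :
  partial (lshift n2 i) (fun y => f (lsubmx y)) x = partial i f (lsubmx x).
Proof.
rewrite /partial /derive; apply: (congr1 (fun q : R -> R^o => lim (q @ 0^'))).
by apply/funext => h /=; rewrite lsubL lsub_l.
Qed.

Lemma partial_rsub_r i (f : 'rV[R]_n2 -> R) x :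
  partial (rshift n1 i) (fun y => f (rsubmx y)) x = partial i f (rsubmx x).
Proof.
rewrite /partial /derive; apply: (congr1 (fun q : R -> R^o => lim (q @ 0^'))).
by apply/funext => h /=; rewrite rsubL rsub_r.
Qed.

Lemma partial_lsub_r i (f : 'rV[R]_n1 -> R) x :
  partial (rshift n1 i) (fun y => f (lsubmx y)) x = 0.
Proof.
rewrite -(partial_cst (rshift n1 i) (f (lsubmx x)) x) /partial /derive.
apply: (congr1 (fun q : R -> R^o => lim (q @ 0^'))); apply/funext => h /=.
by rewrite lsubL lsub_r scaler0 add0r.
Qed.

Lemma partial_rsub_l i (f : 'rV[R]_n2 -> R) x :
  partial (lshift n2 i) (fun y => f (rsubmx y)) x = 0.
Proof.
rewrite -(partial_cst (lshift n2 i) (f (rsubmx x)) x) /partial /derive.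
apply: (congr1 (fun q : R -> R^o => lim (q @ 0^'))); apply/funext => h /=.
by rewrite rsubL rsub_l scaler0 add0r.
Qed.

Let pll i a b x : partial (lshift n2 i) (fun y => prod_metric y (lshift n2 a) (lshift n2 b)) x =
  partial i (fun z => G1 z a b) (lsubmx x).
Proof.
rewrite -(partial_lsub_l i (fun z => G1 z a b)); congr (partial _ _ x).
by apply/funext => y; rewrite block_mxEul.
Qed.

Let prll i a b x :
  partial (rshift n1 i) (fun y => prod_metric y (lshift n2 a) (lshift n2 b)) x = 0.
Proof.
rewrite -[RHS](partial_lsub_r i (fun z => G1 z a b) x); congr (partial _ _ x).
by apply/funext => y; rewrite block_mxEul.
Qed.

Let prr i a b x : partial (rshift n1 i) (fun y => prod_metric y (rshift n1 a) (rshift n1 b)) x =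
  partial i (fun z => G2 z a b) (rsubmx x).
Proof.
rewrite -(partial_rsub_r i (fun z => G2 z a b)); congr (partial _ _ x).
by apply/funext => y; rewrite block_mxEdr.
Qed.

Let plrr i a b x :
  partial (lshift n2 i) (fun y => prod_metric y (rshift n1 a) (rshift n1 b)) x = 0.
Proof.
rewrite -[RHS](partial_rsub_l i (fun z => G2 z a b) x); congr (partial _ _ x).
by apply/funext => y; rewrite block_mxEdr.
Qed.

Let plr i a b x : partial i (fun y => prod_metric y (lshift n2 a) (rshift n1 b)) x = 0.
Proof.
rewrite -[RHS](partial_cst i 0 x); congr (partial _ _ x).
by apply/funext => y; rewrite block_mxEur mxE.
Qed.

Let prl i a b x : partial i (fun y => prod_metric y (rshift n1 a) (lshift n2 b)) x = 0.
Proof.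
rewrite -[RHS](partial_cst i 0 x); congr (partial _ _ x).
by apply/funext => y; rewrite block_mxEdl mxE.
Qed.

Let partialE := (pll, prll, prr, plrr, plr, prl).

Let blockE := (@block_mxEul, @block_mxEur, @block_mxEdl, @block_mxEdr).

Lemma lower_conn_prod_l i x : lower_conn prod_metric (lshift n2 i) x =
  block_mx (lower_conn G1 i (lsubmx x)) 0 0 0.
Proof.
apply/matrixP => j k; rewrite mxE.
case: (split_ordP j) => a ->; case: (split_ordP k) => b ->;
  rewrite ?blockE [RHS]mxE ?partialE;
  by rewrite ?(addr0, add0r, subr0, subrr, mulr0).
Qed.

Lemma lower_conn_prod_r i x : lower_conn prod_metric (rshift n1 i) x =
  block_mx 0 0 0 (lower_conn G2 i (rsubmx x)).
Proof.
apply/matrixP => j k; rewrite mxE.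
case: (split_ordP j) => a ->; case: (split_ordP k) => b ->;
  rewrite ?blockE [RHS]mxE ?partialE;
  by rewrite ?(addr0, add0r, subr0, subrr, mulr0).
Qed.

(** Invertibility matters: [invmx] returns a singular matrix unchanged, which
    blocks do not respect when only one of them is singular. *)
Lemma invmx_prod_metric x : prod_metric x \in unitmx -> invmx (prod_metric x) =
  block_mx (invmx (G1 (lsubmx x))) 0 0 (invmx (G2 (rsubmx x))).
Proof.
move=> u; have := u; rewrite unitmxE det_ublock unitrM => /andP[u1 u2].
rewrite -[RHS](mulKmx u) /prod_metric mulmx_block.
by rewrite !(mulmx0, mul0mx, addr0, add0r) !mulmxV // -scalar_mx_block mulmx1.
Qed.

Lemma conn_prod_l i x : prod_metric x \in unitmx ->
  conn prod_metric (lshift n2 i) x = block_mx (conn G1 i (lsubmx x)) 0 0 0.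
Proof.
move=> u; rewrite conn_lower lower_conn_prod_l invmx_prod_metric // tr_block_mx mulmx_block.
by rewrite !trmx0 !(mulmx0, mul0mx, addr0, add0r) -conn_lower.
Qed.

Lemma conn_prod_r i x : prod_metric x \in unitmx ->
  conn prod_metric (rshift n1 i) x = block_mx 0 0 0 (conn G2 i (rsubmx x)).
Proof.
move=> u; rewrite conn_lower lower_conn_prod_r invmx_prod_metric // tr_block_mx mulmx_block.
by rewrite !trmx0 !(mulmx0, mul0mx, addr0, add0r) -conn_lower.
Qed.

Lemma partial_mx_block p1 p2 q1 q2 i (A : 'rV[R]_(n1 + n2) -> 'M[R]_(p1, q1))
    (B : 'rV[R]_(n1 + n2) -> 'M[R]_(p1, q2)) (C : 'rV[R]_(n1 + n2) -> 'M[R]_(p2, q1))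
    (D : 'rV[R]_(n1 + n2) -> 'M[R]_(p2, q2)) x :
  partial_mx i (fun y => block_mx (A y) (B y) (C y) (D y)) x =
  block_mx (partial_mx i A x) (partial_mx i B x) (partial_mx i C x) (partial_mx i D x).
Proof.
apply/matrixP => j k; rewrite [LHS]mxE.
case: (split_ordP j) => a ->; case: (split_ordP k) => b ->;
  rewrite blockE [RHS]mxE; congr (partial i _ x); apply/funext => y; by rewrite blockE.
Qed.

Lemma partial_mx_lsub_l p q (F : 'rV[R]_n1 -> 'M[R]_(p, q)) i x :
  partial_mx (lshift n2 i) (fun y => F (lsubmx y)) x = partial_mx i F (lsubmx x).
Proof. by apply/matrixP => j k; rewrite !mxE -partial_lsub_l. Qed.

Lemma partial_mx_lsub_r p q (F : 'rV[R]_n1 -> 'M[R]_(p, q)) i x :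
  partial_mx (rshift n1 i) (fun y => F (lsubmx y)) x = 0.
Proof.
by apply/matrixP => j k; rewrite !mxE; exact: partial_lsub_r i (fun z => F z j k) x.
Qed.

Lemma partial_mx_rsub_r p q (F : 'rV[R]_n2 -> 'M[R]_(p, q)) i x :
  partial_mx (rshift n1 i) (fun y => F (rsubmx y)) x = partial_mx i F (rsubmx x).
Proof. by apply/matrixP => j k; rewrite !mxE -partial_rsub_r. Qed.

Lemma partial_mx_rsub_l p q (F : 'rV[R]_n2 -> 'M[R]_(p, q)) i x :
  partial_mx (lshift n2 i) (fun y => F (rsubmx y)) x = 0.
Proof.
by apply/matrixP => j k; rewrite !mxE; exact: partial_rsub_l i (fun z => F z j k) x.
Qed.

(* The blocks of [prod_metric] are only known to be invertible over the range of a
   chart, whereas curvature needs the connection on a neighbourhood. *)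
Section OnOpenSet.
Variable V : set 'rV[R]_(n1 + n2).
Hypotheses (oV : open V) (unitV : forall x, V x -> prod_metric x \in unitmx).

Let pconn_l i j x : V x -> partial_mx i (conn prod_metric (lshift n2 j)) x =
  block_mx (partial_mx i (fun y => conn G1 j (lsubmx y)) x) 0 0 0.
Proof.
move=> Vx; have e y : V y -> conn prod_metric (lshift n2 j) y =
    block_mx (conn G1 j (lsubmx y)) 0 0 0.
  by move=> /unitV; exact: conn_prod_l.
rewrite (partial_mx_ext i oV Vx e).
by rewrite partial_mx_block !(partial_mx_cst i).
Qed.

Let pconn_r i j x : V x -> partial_mx i (conn prod_metric (rshift n1 j)) x =
  block_mx 0 0 0 (partial_mx i (fun y => conn G2 j (rsubmx y)) x).
Proof.
move=> Vx; have e y : V y -> conn prod_metric (rshift n1 j) y =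
    block_mx 0 0 0 (conn G2 j (rsubmx y)).
  by move=> /unitV; exact: conn_prod_r.
rewrite (partial_mx_ext i oV Vx e).
by rewrite partial_mx_block !(partial_mx_cst i).
Qed.

Lemma curvature_prod_ll i j x : V x ->
  curvature_mx prod_metric (lshift n2 i) (lshift n2 j) x =
  block_mx (curvature_mx G1 i j (lsubmx x)) 0 0 0.
Proof.
move=> Vx; rewrite [LHS]/curvature_mx (pconn_l _ j Vx) (pconn_l _ i Vx).
rewrite (conn_prod_l i (unitV Vx)) (conn_prod_l j (unitV Vx)).
rewrite (partial_mx_lsub_l (conn G1 i)) (partial_mx_lsub_l (conn G1 j)).
rewrite /curvature_mx.
move: (partial_mx i _ _) (partial_mx j _ _) (conn G1 i _) (conn G1 j _) => Di Dj ci cj.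
rewrite !mulmx_block !(mulmx0, mul0mx, addr0) !opp_block_mx !add_block_mx.
by rewrite !oppr0 !addr0.
Qed.

Lemma curvature_prod_rr i j x : V x ->
  curvature_mx prod_metric (rshift n1 i) (rshift n1 j) x =
  block_mx 0 0 0 (curvature_mx G2 i j (rsubmx x)).
Proof.
move=> Vx; rewrite [LHS]/curvature_mx (pconn_r _ j Vx) (pconn_r _ i Vx).
rewrite (conn_prod_r i (unitV Vx)) (conn_prod_r j (unitV Vx)).
rewrite (partial_mx_rsub_r (conn G2 i)) (partial_mx_rsub_r (conn G2 j)).
rewrite /curvature_mx.
move: (partial_mx i _ _) (partial_mx j _ _) (conn G2 i _) (conn G2 j _) => Di Dj ci cj.
rewrite !mulmx_block !(mulmx0, mul0mx, addr0, add0r) !opp_block_mx !add_block_mx.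
by rewrite !oppr0 !addr0.
Qed.

Lemma curvature_prod_lr i j x : V x ->
  curvature_mx prod_metric (lshift n2 i) (rshift n1 j) x = 0.
Proof.
move=> Vx; rewrite /curvature_mx (pconn_r _ j Vx) (pconn_l _ i Vx).
rewrite (conn_prod_l i (unitV Vx)) (conn_prod_r j (unitV Vx)).
rewrite (partial_mx_lsub_r (conn G1 i)) (partial_mx_rsub_l (conn G2 j)).
move: (conn G1 i _) (conn G2 j _) => ci cj.
rewrite !mulmx_block !(mulmx0, mul0mx, addr0, add0r) !block_mx_const.
by rewrite !(addr0, subr0).
Qed.

Lemma curvature_prod_rl i j x : V x ->
  curvature_mx prod_metric (rshift n1 i) (lshift n2 j) x = 0.
Proof.
move=> Vx; rewrite /curvature_mx (pconn_l _ j Vx) (pconn_r _ i Vx).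
rewrite (conn_prod_l j (unitV Vx)) (conn_prod_r i (unitV Vx)).
rewrite (partial_mx_lsub_r (conn G1 j)) (partial_mx_rsub_l (conn G2 i)).
move: (conn G1 j _) (conn G2 i _) => cj ci.
rewrite !mulmx_block !(mulmx0, mul0mx, addr0, add0r) !block_mx_const.
by rewrite !(addr0, subr0).
Qed.

Lemma ricci_prod x : V x -> ricci prod_metric x =
  block_mx (ricci G1 (lsubmx x)) 0 0 (ricci G2 (rsubmx x)).
Proof.
move=> Vx; apply/matrixP => j k; rewrite [LHS]ricciE big_split_ord /=.
case: (split_ordP j) => a ->.
  rewrite [X in _ + X]big1 ?addr0; last first.
    by move=> i _; rewrite (curvature_prod_rl i a Vx) mxE.
  under eq_bigr => i _ do rewrite (curvature_prod_ll i a Vx).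
  case: (split_ordP k) => b ->; rewrite blockE.
    by rewrite [RHS]ricciE; apply: eq_bigr => i _; rewrite block_mxEul.
  by rewrite mxE; apply: big1 => i _; rewrite block_mxEdl mxE.
rewrite [X in X + _]big1 ?add0r; last first.
  by move=> i _; rewrite (curvature_prod_lr i a Vx) mxE.
under eq_bigr => i _ do rewrite (curvature_prod_rr i a Vx).
case: (split_ordP k) => b ->; rewrite blockE.
  by rewrite mxE; apply: big1 => i _; rewrite block_mxEur mxE.
by rewrite [RHS]ricciE; apply: eq_bigr => i _; rewrite block_mxEdr.
Qed.

Lemma ricci_field_prod_l i x : V x -> ricci_field prod_metric (lshift n2 i) x =
  row_mx (ricci_field G1 i (lsubmx x)) 0.
Proof.
move=> Vx; rewrite /ricci_field ricci_prod // invmx_prod_metric; last exact: unitV.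
rewrite /block_mx -/(block_mx _ _ _ _) rowKu row_row_mx linear0 mul_row_block.
by rewrite !(mul0mx, mulmx0, addr0).
Qed.

Lemma ricci_field_prod_r i x : V x -> ricci_field prod_metric (rshift n1 i) x =
  row_mx 0 (ricci_field G2 i (rsubmx x)).
Proof.
move=> Vx; rewrite /ricci_field ricci_prod // invmx_prod_metric; last exact: unitV.
rewrite /block_mx -/(block_mx _ _ _ _) rowKd row_row_mx linear0 mul_row_block.
by rewrite !(mul0mx, mulmx0, add0r).
Qed.

Lemma partial_mx_row p q1 q2 i (A : 'rV[R]_(n1 + n2) -> 'M[R]_(p, q1))
    (B : 'rV[R]_(n1 + n2) -> 'M[R]_(p, q2)) x :
  partial_mx i (fun y => row_mx (A y) (B y)) x =
  row_mx (partial_mx i A x) (partial_mx i B x).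
Proof.
apply/matrixP => j k; rewrite [LHS]mxE.
case: (split_ordP k) => b ->; rewrite ?(row_mxEl, row_mxEr) [RHS]mxE;
  congr (partial i _ x); apply/funext => y; by rewrite ?(row_mxEl, row_mxEr).
Qed.

(** Ric(d_j) depends only on the point of the first factor and is tangent to it,
    where the connection matrix along the second factor is zero. *)
Lemma cov_ricci_field_prod_rl i j x : V x ->
  cov prod_metric (rshift n1 i) (ricci_field prod_metric (lshift n2 j)) x = 0.
Proof.
move=> Vx; rewrite covE (partial_mx_ext _ oV Vx (fun y => @ricci_field_prod_l j y)).
rewrite partial_mx_row (partial_mx_lsub_r (ricci_field G1 j)) (partial_mx_cst _ 0).
rewrite (ricci_field_prod_l j Vx) (conn_prod_r i (unitV Vx)) mul_row_block.
by rewrite !(mul0mx, mulmx0, addr0) row_mx0 addr0.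
Qed.

Lemma cov_ricci_field_prod_lr i j x : V x ->
  cov prod_metric (lshift n2 i) (ricci_field prod_metric (rshift n1 j)) x = 0.
Proof.
move=> Vx; rewrite covE (partial_mx_ext _ oV Vx (fun y => @ricci_field_prod_r j y)).
rewrite partial_mx_row (partial_mx_rsub_l (ricci_field G2 j)) (partial_mx_cst _ 0).
rewrite (ricci_field_prod_r j Vx) (conn_prod_l i (unitV Vx)) mul_row_block.
by rewrite !(mul0mx, mulmx0, addr0) row_mx0 addr0.
Qed.

Lemma ricci_field_prod_orth i j x : V x ->
  ricci_field prod_metric (lshift n2 i) x *m prod_metric x
    *m (ricci_field prod_metric (rshift n1 j) x)^T = 0.
Proof.
move=> Vx; rewrite ricci_field_prod_l // ricci_field_prod_r // /prod_metric.
rewrite mul_row_block tr_row_mx mul_row_col trmx0.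
by rewrite !(mul0mx, mulmx0, addr0).
Qed.

End OnOpenSet.

End Product.
(** * Uniqueness for linear first-order systems *)

Section Uniqueness.
Variables (R : realType) (n K q : nat) (V : set 'rV[R]_n).
Variables (B : 'I_n -> 'rV[R]_n -> 'M[R]_K) (Psi : 'rV[R]_n -> 'M[R]_(K, q)).
Hypotheses (oV : open V) (sB : forall i, smooth_mx V (B i)) (sPsi : smooth_mx V Psi).
Hypothesis system : forall i x, V x -> partial_mx i Psi x = B i x *m Psi x.

Lemma smooth_mx_bounded p r (F : 'rV[R]_n -> 'M[R]_(p, r)) x : V x -> smooth_mx V F ->
  exists2 M : R, 0 <= M & \forall y \near x, forall a b, `|F y a b| <= M.
Proof.
move=> Vx sF; pose S y := \sum_a \sum_b F y a b * F y a b.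
have cS : {for x, continuous S}.
  apply: (smooth_continuous _ Vx); apply: smooth_sum => // a.
  by apply: smooth_sum => // b; apply: smoothM => //; exact: sF.
have S0 y a b : F y a b * F y a b <= S y.
  rewrite /S (bigD1 a) //= (bigD1 b) //= -addrA lerDl addr_ge0 // sumr_ge0 // => *.
    by rewrite -expr2 sqr_ge0.
  by apply: sumr_ge0 => *; rewrite -expr2 sqr_ge0.
(* Near [x] every entry [u] has [`|u| <= 1 + u ^+ 2 <= 1 + S y], and [S y < S x + 1]. *)
exists (S x + 2).
  by rewrite addr_ge0 //; apply: sumr_ge0 => *; apply: sumr_ge0 => *; rewrite -expr2 sqr_ge0.
have /cvgr_dist_lt /(_ 1 ltr01) := cS; apply: filterS => y Sy a b.
have := S0 y a b; have : S y < S x + 1 by move: Sy; rewrite ltr_norml => /andP[]; lra.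
by rewrite ler_norml; move: (F y a b) (S y) (S x) => u s t ? ?; apply/andP; split; nra.
Qed.

(** On a box of half-width [d] around [x] the mean value formula improves a bound
    of [Psi] by the factor [d * n * K * M], where [M] bounds the coefficients. For
    small [d] this factor is at most 1/2, and iterating the improvement leaves
    only [Psi = 0] on the box. *)
Lemma linear_system_unique x : V x -> Psi x = 0 -> \forall y \near x, Psi y = 0.
Proof.
move=> Vx Px0.
have [m m0 Pm] := smooth_mx_bounded Vx sPsi.
have [M M0 BM] : exists2 M : R, 0 <= M & \forall y \near x, forall i a b, `|B i y a b| <= M.
  have /choice[M MP] i : exists M : R, 0 <= M /\ \forall y \near x, forall a b, `|B i y a b| <= M.
    by have [M] := smooth_mx_bounded Vx (sB i); exists M.
  exists (\sum_i M i); first by apply: sumr_ge0 => i _; case: (MP i).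
  have : \forall y \near x, forall i, forall a b, `|B i y a b| <= M i.
    by apply: (@filter_forall _ _ _ (nbhs x)) => i; case: (MP i).
  apply: filterS => y h i a b; apply: le_trans (h i a b) _.
  by rewrite (bigD1 i) //= lerDl sumr_ge0 // => j _; case: (MP j).
have [e e0 boxP] : exists2 e : R, 0 < e & forall y : 'rV[R]_n, (forall k, `|y 0 k - x 0 k| < e) ->
    [/\ V y, forall a b, `|Psi y a b| <= m & forall i a b, `|B i y a b| <= M].
  apply: nbhs_box; near=> y; split.
  - by near: y; exact: (open_nbhs_nbhs (conj oV Vx)).
  - by near: y.
  - by near: y.
pose c := n%:R * (K%:R * M).
have c0 : 0 <= c by rewrite !mulr_ge0.
(* [c + 1] rather than [c], which may be zero. *)
pose d := Num.min e (c + 1)^-1 / 2.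
have mp : 0 < Num.min e (c + 1)^-1 by rewrite lt_min e0 invr_gt0; lra.
have d0 : 0 < d by rewrite divr_gt0.
have de : d < e.
  by apply: (@lt_le_trans _ _ (Num.min e (c + 1)^-1)); rewrite ?ge_min ?lexx // /d; lra.
have cd : d * c <= 2^-1.
  have : d <= (c + 1)^-1 / 2 by rewrite ler_pM2r // ge_min lexx orbT.
  have c1 : (c + 1)^-1 * (c + 1) = 1 by rewrite mulVf // gt_eqF //; lra.
  have : 0 < (c + 1)^-1 by rewrite invr_gt0; lra.
  by move: c1; move: ((c + 1)^-1) => u; nra.
have decay k : forall y : 'rV[R]_n, (forall l, `|y 0 l - x 0 l| < d) -> forall a b,
    `|Psi y a b| <= m / 2 ^+ k.
  elim: k => [|k IH] y yd a b.
    by rewrite expr0 divr1; case: (boxP y) => // l; exact: lt_trans (yd l) de.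
  have inbox (z : 'rV[R]_n) : (forall l, `|z 0 l - x 0 l| <= `|y 0 l - x 0 l|) ->
      forall l, `|z 0 l - x 0 l| < d.
    by move=> zy l; exact: le_lt_trans (zy l) (yd l).
  have inV (z : 'rV[R]_n) : (forall l, `|z 0 l - x 0 l| < d) -> V z.
    by move=> zd; case: (boxP z) => // l; exact: lt_trans (zd l) de.
  have [i z /inbox/inV Vz|z zb] := @mean_value_box _ _ (fun y => Psi y a b) x y.
    exact: smooth_derivable (sPsi a b) Vz.
  rewrite Px0 mxE subr0 => ->.
  apply: (@le_trans _ _ (\sum_(i < n) d * (K%:R * M * (m / 2 ^+ k)))).
    apply: (le_trans (ler_norm_sum _ _ _)); apply: ler_sum => i _; rewrite normrM.
    have zd := inbox _ (zb i).
    apply: ler_pM => //; first exact: ltW.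
    have /matrixP/(_ a b) := system i (inV _ zd); rewrite mxE => ->.
    rewrite mxE; apply: (le_trans (ler_norm_sum _ _ _)).
    apply: (@le_trans _ _ (\sum_(l < K) M * (m / 2 ^+ k))).
      apply: ler_sum => l _; rewrite normrM; apply: ler_pM => //; last exact: IH.
      by case: (boxP (z i)) => // l'; exact: lt_trans (zd l') de.
    by rewrite sumr_const card_ord -mulrA mulr_natl.
  have -> : m / 2 ^+ k.+1 = 2^-1 * (m / 2 ^+ k) by rewrite exprS invfM mulrCA.
  rewrite sumr_const card_ord -[_ *+ n]mulr_natl.
  have : 0 <= m / 2 ^+ k by rewrite divr_ge0 // exprn_ge0.
  move: cd; rewrite /c; move: (m / 2 ^+ k) => u cd u0.
  have -> : n%:R * (d * (K%:R * M * u)) = d * (n%:R * (K%:R * M)) * u by ring.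
  by rewrite ler_wpM2r.
have : nbhs x (fun y : 'rV[R]_n => forall l, `|y 0 l - x 0 l| < d).
  apply: (@filter_forall _ _ _ (nbhs x)) => l.
  have /cvgr_dist_lt /(_ d d0) := @coord_continuous R 1 n 0 l x.
  by apply: filterS => y; rewrite distrC.
apply: filterS => y /decay yd; apply/matrixP => a b; rewrite mxE; apply/eqP.
apply: contraT => P0; have {}P0 : 0 < `|Psi y a b| by rewrite normr_gt0.
pose N := Num.bound (m / `|Psi y a b|).
have : m / `|Psi y a b| < N%:R by rewrite archi_boundP // divr_ge0.
rewrite ltr_pdivrMr // => mN; have := yd N a b; rewrite ler_pdivlMr ?exprn_gt0 // => h.
have : N%:R * `|Psi y a b| <= `|Psi y a b| * 2 ^+ N.
  by rewrite mulrC ler_pM2l // -natrX ler_nat ltnW // ltn_expl.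
by move=> h'; have := lt_le_trans mN (le_trans h' h); rewrite ltxx.
Unshelve. all: by end_near. Qed.

End Uniqueness.
(** * The chain rule and invariance of the dimension *)

Section ChainRule.
Variables (R : realType).

Lemma partial_coord n (i j : 'I_n) (x : 'rV[R]_n) :
  partial i (fun y => y 0 j) x = (i == j)%:R.
Proof.
rewrite /partial /derive; apply: cvg_lim => //.
apply: cvg_near_cst; near=> h.
have h0 : h != 0 by near: h; exact: nbhs_dnbhs_neq.
by rewrite /= !mxE eqxx /= addrK [_ *: _]mulKf // eq_sym.
Unshelve. all: by end_near. Qed.

Lemma jacobian_id n (F : 'rV[R]_n -> 'rV[R]_n) (V : set 'rV[R]_n) x :
  open V -> V x -> (forall y, V y -> F y = y) -> jacobian F x = 1%:M.
Proof.
move=> oV Vx Fid; apply/matrixP => i j; rewrite !mxE -(partial_coord i j x).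
by apply: (partial_ext _ oV Vx) => y /Fid ->.
Qed.

(** The mean value formula on the box spanned by [H y] and [H z] expresses the difference quotient of the
    composite through difference quotients of [H] and partial derivatives of [f]
    at points that tend to [H y]. *)
Lemma partial_comp m n (H : 'rV[R]_m -> 'rV[R]_n) (f : 'rV[R]_n -> R)
    (W : set 'rV[R]_m) (V : set 'rV[R]_n) (j : 'I_m) (y : 'rV[R]_m) :
  open W -> open V -> W y -> V (H y) -> smooth_mx W H -> smooth V f ->
  partial j (fun z => f (H z)) y =
  \sum_i partial j (fun z => H z 0 i) y * partial i f (H y).
Proof.
move=> oW oV Wy VHy sH sf; set x := H y.
have [e e0 boxV] := nbhs_box (open_nbhs_nbhs (conj oV VHy)).
(* [z] picks the intermediate points of the mean value formula; for [t] outside of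
   the range of the formula the default [x] keeps the box estimate valid. *)
pose D (t : R) : 'rV[R]_n := H (t *: basis_vec R j + y).
have /choice[z zP] (t : R) : exists z : 'I_n -> 'rV[R]_n,
    (forall i k, `|z i 0 k - x 0 k| <= `|D t 0 k - x 0 k|) /\
    ((forall k, `|D t 0 k - x 0 k| < e) ->
      f (D t) - f x = \sum_i (D t 0 i - x 0 i) * partial i f (z i)).
  have [te|te] := pselect (forall k, `|D t 0 k - x 0 k| < e); last first.
    by exists (fun=> x); split => // i k; rewrite subrr normr0.
  have [|z zb zE] := @mean_value_box _ _ f x (D t); last by exists z.
  move=> i z zb; apply: (smooth_derivable sf); apply: boxV => k.
  exact: le_lt_trans (zb k) (te k).
have cH k : {for y, continuous (fun z => H z 0 k)} by exact: smooth_continuous (sH 0 k) Wy.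
have cline : (t *: basis_vec R j + y) @[t --> (0 : R)] --> y.
  rewrite -[X in _ --> X]add0r -(scale0r (basis_vec R j)).
  by apply: cvgD; [apply: cvgZr_tmp; exact: cvg_id|exact: cvg_cst].
have cD k : D t 0 k @[t --> (0 : R)^'] --> x 0 k.
  have := cvg_comp _ _ cline (cH k); apply: cvg_trans.
  by apply: cvg_app; exact: nbhs_dnbhs.
have cz i : z t i @[t --> (0 : R)^'] --> x.
  apply/cvg_ballP => d d0.
  have : \forall t \near (0 : R)^', forall k, `|x 0 k - D t 0 k| < d.
    by apply: (@filter_forall _ _ _ _) => k; exact: cvgr_dist_lt (cD k) _ d0.
  apply: filterS => t tD; split => // a k; rewrite !ord1 /ball /= distrC.
  by apply: le_lt_trans ((zP t).1 i k) _; rewrite distrC.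
have cf i : {for x, continuous (partial i f)}.
  by apply: (smooth_continuous _ VHy); exact: smooth_partial.
rewrite [LHS]/partial /derive; apply: cvg_lim => //.
have dH i : t^-1 * (D t 0 i - x 0 i) @[t --> (0 : R)^'] --> partial j (fun z => H z 0 i) y.
  exact: smooth_derivable (sH 0 i) Wy.
have cS : \sum_i (t^-1 * (D t 0 i - x 0 i)) * partial i f (z t i) @[t --> (0 : R)^']
    --> \sum_i partial j (fun z => H z 0 i) y * partial i f x.
  apply: cvg_big => [|i _]; first exact: add_continuous.
  by apply: cvgM (dH i) _; exact: cvg_comp (cz i) (cf i).
apply: cvg_trans cS; apply: near_eq_cvg.
have : \forall t \near (0 : R)^', forall k, `|x 0 k - D t 0 k| < e.
  by apply: (@filter_forall _ _ _ _) => k; exact: cvgr_dist_lt (cD k) _ e0.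
apply: filterS => t tD /=; rewrite [f _ - f _](zP t).2; last by move=> k; rewrite distrC.
by rewrite [_ *: _]mulr_sumr; apply: eq_bigr => i _; rewrite mulrA.
Qed.

(** Tangent vectors are rows, so the Jacobian of the inner map stands on the left. *)
Lemma jacobian_comp_id m n (H : 'rV[R]_m -> 'rV[R]_n) (F : 'rV[R]_n -> 'rV[R]_m)
    (W : set 'rV[R]_m) (V : set 'rV[R]_n) (y : 'rV[R]_m) :
  open W -> open V -> W y -> V (H y) -> smooth_mx W H -> smooth_mx V F ->
  (forall z, W z -> F (H z) = z) -> jacobian H y *m jacobian F (H y) = 1%:M.
Proof.
move=> oW oV Wy VHy sH sF FH; apply/matrixP => i j; rewrite !mxE.
rewrite -(partial_coord i j y) -(partial_ext i oW Wy (f := fun z => F (H z) 0 j)).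
  rewrite (partial_comp i oW oV Wy VHy sH (sF 0 j)).
  by apply: eq_bigr => k _; rewrite !mxE.
by move=> z /FH ->.
Qed.

End ChainRule.
(** * Complex matrices as real matrices *)

Section Realification.
Variable R : realType.
Implicit Types p q r : nat.

Definition real_col p q (Z : 'M[R[i]]_(p, q)) : 'M[R]_(p + p, q) :=
  col_mx (map_mx (@complex.Re R) Z) (map_mx (@complex.Im R) Z).

(** Multiplication by [A] in the real coordinates of [real_col]. *)
Definition real_mx p q (A : 'M[R[i]]_(p, q)) : 'M[R]_(p + p, q + q) :=
  let a := map_mx (@complex.Re R) A in let b := map_mx (@complex.Im R) A in
  block_mx a (- b) b a.

Lemma Re_sum (I : finType) (z : I -> R[i]) :
  complex.Re (\sum_k z k) = \sum_k complex.Re (z k).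
Proof. by apply: (big_morph (@complex.Re R)) => // -[a b] [c d]. Qed.

Lemma Im_sum (I : finType) (z : I -> R[i]) :
  complex.Im (\sum_k z k) = \sum_k complex.Im (z k).
Proof. by apply: (big_morph (@complex.Im R)) => // -[a b] [c d]. Qed.

Lemma map_ReM p q r (A : 'M[R[i]]_(p, q)) (B : 'M[R[i]]_(q, r)) :
  map_mx (@complex.Re R) (A *m B) =
  map_mx (@complex.Re R) A *m map_mx (@complex.Re R) B
  - map_mx (@complex.Im R) A *m map_mx (@complex.Im R) B.
Proof.
apply/matrixP => a b; rewrite !mxE Re_sum -sumrB; apply: eq_bigr => k _; rewrite !mxE.
by case: (A a k) (B k b) => [? ?] [? ?].
Qed.

Lemma map_ImM p q r (A : 'M[R[i]]_(p, q)) (B : 'M[R[i]]_(q, r)) :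
  map_mx (@complex.Im R) (A *m B) =
  map_mx (@complex.Im R) A *m map_mx (@complex.Re R) B
  + map_mx (@complex.Re R) A *m map_mx (@complex.Im R) B.
Proof.
apply/matrixP => a b; rewrite !mxE Im_sum -big_split; apply: eq_bigr => k _; rewrite !mxE.
by case: (A a k) (B k b) => [? ?] [? ?] /=; rewrite addrC.
Qed.

Lemma real_col_mul p q r (A : 'M[R[i]]_(p, q)) (Z : 'M[R[i]]_(q, r)) :
  real_col (A *m Z) = real_mx A *m real_col Z.
Proof. by rewrite /real_col /real_mx mul_block_col map_ReM map_ImM mulNmx. Qed.

Lemma real_mx_mul p q r (A : 'M[R[i]]_(p, q)) (B : 'M[R[i]]_(q, r)) :
  real_mx (A *m B) = real_mx A *m real_mx B.
Proof.
rewrite /real_mx mulmx_block map_ReM map_ImM !(mulNmx, mulmxN).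
by congr block_mx; rewrite ?opprD // addrC.
Qed.

Lemma real_colD p q (Y Z : 'M[R[i]]_(p, q)) : real_col (Y + Z) = real_col Y + real_col Z.
Proof.
rewrite /real_col add_col_mx; congr col_mx; apply/matrixP => a b; rewrite !mxE;
  by case: (Y a b) (Z a b) => [? ?] [? ?].
Qed.

Lemma real_colZ p q (t : R) (Z : 'M[R[i]]_(p, q)) :
  real_col (t%:C%C *: Z) = t *: real_col Z.
Proof.
rewrite /real_col scale_col_mx; congr col_mx; apply/matrixP => a b; rewrite !mxE;
  by case: (Z a b) => [u v] /=; rewrite mul0r ?subr0 ?addr0.
Qed.

Lemma real_col0 p q : real_col (0 : 'M[R[i]]_(p, q)) = 0.
Proof. by rewrite -col_mx0; congr col_mx; apply/matrixP => a b; rewrite !mxE. Qed.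

Lemma real_col_sum p q (I : finType) (Z : I -> 'M[R[i]]_(p, q)) :
  real_col (\sum_k Z k) = \sum_k real_col (Z k).
Proof.
exact: (big_morph (@real_col p q) (@real_colD p q) (@real_col0 p q)).
Qed.

Lemma real_col_eq0 p q (Z : 'M[R[i]]_(p, q)) : real_col Z = 0 -> Z = 0.
Proof.
rewrite /real_col -col_mx0 => /eq_col_mx[/matrixP h1 /matrixP h2].
apply/matrixP => a b; have := h1 a b; have := h2 a b; rewrite !mxE.
by case: (Z a b) => u v /= -> ->.
Qed.

Lemma real_mxD p q (A B : 'M[R[i]]_(p, q)) : real_mx (A + B) = real_mx A + real_mx B.
Proof.
rewrite /real_mx add_block_mx; congr block_mx; apply/matrixP => a b; rewrite !mxE;
  by case: (A a b) (B a b) => [? ?] [? ?] //=; rewrite opprD.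
Qed.

Lemma real_mx_scalar p (t : R) : real_mx (t%:C%C%:M : 'M[R[i]]_p) = t%:M.
Proof.
rewrite /real_mx scalar_mx_block; congr block_mx; apply/matrixP => a b; rewrite !mxE;
  by case: eqP => _; rewrite ?mulr1n ?mulr0n //= oppr0.
Qed.

Lemma real_clifford_rep n N (gamma : 'I_n -> 'M[R[i]]_N) : clifford_rep gamma ->
  forall j k, real_mx (gamma j) *m real_mx (gamma k) + real_mx (gamma k) *m real_mx (gamma j)
    = (- ((j == k)%:R *+ 2))%:M.
Proof.
move=> h j k; rewrite -!real_mx_mul -real_mxD h -real_mx_scalar; congr (real_mx (_%:M)).
by rewrite rmorphN rmorphMn /= rmorph_nat.
Qed.

Lemma real_col_clifford n N q (gamma : 'I_n -> 'M[R[i]]_N) v (Z : 'M[R[i]]_(N, q)) :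
  real_col (clifford gamma v *m Z) = cliff (fun j => real_mx (gamma j)) v *m real_col Z.
Proof.
rewrite /clifford /cliff !mulmx_suml real_col_sum; apply: eq_bigr => j _.
by rewrite -!scalemxAl real_colZ real_col_mul.
Qed.

Lemma real_col_spin_rep n N q (gamma : 'I_n -> 'M[R[i]]_N) (w : 'I_n -> 'I_n -> R)
    (Z : 'M[R[i]]_(N, q)) :
  real_col (4^-1 *: \sum_j \sum_k (w j k)%:C%C *: (gamma j *m (gamma k *m Z))) =
  spin_rep (fun j => real_mx (gamma j)) (\matrix_(j, k) w j k) *m real_col Z.
Proof.
have -> : (4^-1 : R[i]) = (4^-1)%:C%C by rewrite fmorphV rmorph_nat.
rewrite real_colZ /spin_rep -scalemxAl; congr (_ *: _).
rewrite real_col_sum mulmx_suml; apply: eq_bigr => j _.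
rewrite real_col_sum mulmx_suml; apply: eq_bigr => k _.
by rewrite real_colZ !real_col_mul mxE -scalemxAl mulmxA.
Qed.

Lemma partial_mx_real_col n p q i (F : 'rV[R]_n -> 'M[R[i]]_(p, q)) x :
  partial_mx i (fun y => real_col (F y)) x = real_col (cpartial_mx i F x).
Proof.
apply/matrixP => a b; rewrite [LHS]mxE; case: (split_ordP a) => k ->.
  rewrite col_mxEu !mxE /=; congr (partial i _ x).
  by apply/funext => y; rewrite col_mxEu mxE.
rewrite col_mxEd !mxE /=; congr (partial i _ x).
by apply/funext => y; rewrite col_mxEd mxE.
Qed.

Lemma smooth_real_col n p q (V : set 'rV[R]_n) (F : 'rV[R]_n -> 'M[R[i]]_(p, q)) :
  csmooth_mx V F -> smooth_mx V (fun y => real_col (F y)).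
Proof.
move=> sF a b; case: (split_ordP a) => k ->; have [sRe sIm] := sF k b.
  by rewrite (_ : (fun _ => _) = fun y => complex.Re (F y k b)) //;
     apply/funext => y; rewrite col_mxEu mxE.
by rewrite (_ : (fun _ => _) = fun y => complex.Im (F y k b)) //;
   apply/funext => y; rewrite col_mxEd mxE.
Qed.

End Realification.
(** * Charts and product charts *)

Section Charts.
Variable R : realType.

(** The image is cut out of the open range of the chart by the preimage of [A] under
    the continuous inverse of the chart. *)
Lemma open_chart_image (T : topologicalType) n (c : chart R T n) (A : set T) :
  is_chart c -> open A -> open (cmap c @` (cdom c `&` A)).
Proof.
move=> [_ oran cK _ ccont] oA; rewrite openE => _ [p [cp Ap] <-].
have rp : crange c (cmap c p) by exists p.
have : nbhs (cmap c p) (fun y => crange c y /\ A (cinv c y)).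
  apply: filterI; first exact: (open_nbhs_nbhs (conj oran rp)).
  by apply: (ccont _ rp); rewrite cK //; exact: (open_nbhs_nbhs (conj oA Ap)).
apply: filterS => _ [[p' cp' <-]]; rewrite cK // => Ap'.
by exists p'.
Qed.

Lemma continuous_lsubmx n1 n2 : continuous (@lsubmx R 1 n1 n2).
Proof. by move=> x; apply: differentiable_continuous; exact: differentiable_lsubmx. Qed.

Lemma continuous_rsubmx n1 n2 : continuous (@rsubmx R 1 n1 n2).
Proof. by move=> x; apply: differentiable_continuous; exact: differentiable_rsubmx. Qed.

Lemma crange_prod (T1 T2 : Type) n1 n2 (c1 : chart R T1 n1) (c2 : chart R T2 n2) x :
  crange (prod_chart c1 c2) x <-> crange c1 (lsubmx x) /\ crange c2 (rsubmx x).
Proof.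
split=> [[[p1 p2] /= [c1p c2p] <-]|[[p1 c1p e1] [p2 c2p e2]]].
  by rewrite row_mxKl row_mxKr; split; [exists p1|exists p2].
by exists (p1, p2); rewrite //= e1 e2 hsubmxK.
Qed.

Lemma continuous_row_mx (T : topologicalType) n1 n2 (f : T -> 'rV[R]_n1)
    (g : T -> 'rV[R]_n2) p : {for p, continuous f} -> {for p, continuous g} ->
  {for p, continuous (fun y => row_mx (f y) (g y))}.
Proof.
move=> cf cg; apply/cvg_ballP => d d0.
near=> y; split => // a k; rewrite !ord1.
case: (split_ordP k) => l ->; rewrite ?row_mxEl ?row_mxEr.
  have : ball (f p) d (f y) by near: y; move/cvg_ballP: cf; exact.
  by move=> [_]; exact.
have : ball (g p) d (g y) by near: y; move/cvg_ballP: cg; exact.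
by move=> [_]; exact.
Unshelve. all: by end_near. Qed.

Lemma prod_chart_is_chart (T1 T2 : topologicalType) n1 n2
    (c1 : chart R T1 n1) (c2 : chart R T2 n2) :
  is_chart c1 -> is_chart c2 -> is_chart (prod_chart c1 c2).
Proof.
move=> [od1 or1 K1 cm1 ci1] [od2 or2 K2 cm2 ci2]; split.
- rewrite (_ : cdom _ = fst @^-1` cdom c1 `&` snd @^-1` cdom c2) //.
  by apply: openI; apply: open_comp => // -[p1 p2] _; [exact: cvg_fst|exact: cvg_snd].
- rewrite (_ : crange _ = lsubmx @^-1` crange c1 `&` rsubmx @^-1` crange c2); last first.
    by apply/seteqP; split=> x /crange_prod.
  apply: openI; apply: open_comp => // x _; first exact: continuous_lsubmx.
  exact: continuous_rsubmx.
- by move=> [p1 p2] [/= ? ?]; rewrite row_mxKl row_mxKr K1 // K2.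
- move=> [p1 p2] [/= h1 h2]; apply: continuous_row_mx => /=.
    by apply: (@continuous_comp _ _ _ fst); [exact: cvg_fst|exact: cm1].
  by apply: (@continuous_comp _ _ _ snd); [exact: cvg_snd|exact: cm2].
- move=> x /crange_prod[h1 h2] /=.
  have e1 : {for x, continuous (fun y => cinv c1 (lsubmx y))}.
    exact: (cvg_comp _ _ (@continuous_lsubmx n1 n2 x) (ci1 _ h1)).
  have e2 : {for x, continuous (fun y => cinv c2 (rsubmx y))}.
    exact: (cvg_comp _ _ (@continuous_rsubmx n1 n2 x) (ci2 _ h2)).
  exact: (cvg_pair e1 e2).
Qed.

End Charts.
(** * Ricci Killing spinors have no zeros *)

Lemma sum_basis_vec (R : realType) n p q (i : 'I_n) (F : 'I_n -> 'M[R[i]]_(p, q)) :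
  \sum_k ((basis_vec R i) 0 k)%:C%C *: F k = F i.
Proof.
rewrite (bigD1 i) //= big1 ?addr0 => [|k /negPf ki].
  by rewrite mxE !eqxx scale1r.
by rewrite mxE ki andbF scale0r.
Qed.

Section FrameCoefficients.
Variables (R : realType) (n : nat) (G E : 'rV[R]_n -> 'M[R]_n).

Let mulmx_row p (A : 'M[R]_(p, n)) (B : 'M[R]_n) j k :
  (row j A *m (row k B)^T) 0 0 = (A *m B^T) j k.
Proof. by rewrite !mxE; apply: eq_bigr => l _; rewrite !mxE. Qed.

Lemma inner_cov_frame i j k x :
  inner G x (cov G i (fun y => row j (E y)) x) (row k (E x)) = frame_conn G E i x j k.
Proof.
rewrite /inner covE.
have -> : partial_mx i (fun y => row j (E y)) x = row j (partial_mx i E x).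
  apply/rowP => a; rewrite !mxE; congr (partial i _ x).
  by apply/funext => y; rewrite mxE.
rewrite /frame_conn; move: (partial_mx i E x) (conn G i x) (E x) (G x) => D c e h.
have -> : row j D + row j e *m c = row j (D + e *m c).
  by rewrite -row_mul; apply/rowP => a; rewrite !mxE.
by rewrite -row_mul mulmx_row.
Qed.

Lemma inner_ricci_frame i j x : G x \in unitmx ->
  inner G x (ricci_endo G x (basis_vec R i)) (row j (E x)) = frame_ricci G E i x 0 j.
Proof.
move=> uG; rewrite /inner /ricci_endo mulmxKV // -rowE /frame_ricci.
rewrite [LHS]mxE [RHS]mxE; apply: eq_bigr => l _; congr (_ * _).
by rewrite !mxE.
Qed.

End FrameCoefficients.

Section RicciKilling.
Variables (R : realType) (n : nat).
Variables (gamma : 'I_n -> 'M[R[i]]_(spinor_rank n)) (gammaP : clifford_rep gamma).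
Variables (M : riem_data R n) (hM : is_riemannian M).
Variables (S : spin_data M (spinor_rank n)) (hS : is_spin_structure gamma S).
Variable psi : sidx S -> M -> 'cV[R[i]]_(spinor_rank n).
Hypothesis psi_field : is_spinor_field psi.
Variable mu : R.
Hypothesis killing : forall (a : sidx S) (c : idx M) p, sdom a p -> cdom (atlas c) p ->
  let x := cmap (atlas c) p in
  forall v : 'rV[R]_n, spin_nabla gamma psi a c x v =
    mu%:C%C *: (clifford_mult gamma a c x (ricci_endo (metric c) x v) *m psi a p).

Definition trivialized (a : sidx S) (c : idx M) : set 'rV[R]_n :=
  cmap (atlas c) @` (cdom (atlas c) `&` sdom a).

Definition local_spinor (a : sidx S) (c : idx M) (x : 'rV[R]_n) :=
  real_col (psi a (cinv (atlas c) x)).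

Let g j := real_mx (gamma j).

Lemma atlas_chart c : is_chart (atlas c : chart R M n).
Proof. by case: hM => [[_ _ [h _] _ _] _]; exact: h. Qed.

Lemma cmapK (c : idx M) p : cdom (atlas c) p -> cinv (atlas c) (cmap (atlas c) p) = p.
Proof. by case: (atlas_chart c) => _ _ h _ _; exact: h. Qed.

Lemma open_trivialized a c : open (trivialized a c).
Proof.
apply: open_chart_image; first exact: atlas_chart.
by case: hS => [[h _] _ _ _ _]; exact: h.
Qed.

Lemma trivialized_crange a c : trivialized a c `<=` crange (atlas c).
Proof. by move=> _ [p [cp _] <-]; exists p. Qed.

Lemma smooth_metric a c : smooth_mx (trivialized a c) (metric c).
Proof.
case: hM => _ [sG _ _ _]; apply: smooth_mx_sub (sG c); exact: trivialized_crange.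
Qed.

Lemma sym_metric a c x : trivialized a c x -> (metric c x)^T = metric c x.
Proof. by case: hM => _ [_ symG _ _] /trivialized_crange; exact: symG. Qed.

Lemma smooth_frame a c : smooth_mx (trivialized a c) (frame a c).
Proof. by case: hS => _ h _ _ _; case: (h a c). Qed.

Lemma orth_frame a c x : trivialized a c x ->
  frame a c x *m metric c x *m (frame a c x)^T = 1%:M.
Proof. by case: hS => _ h _ _ _; case: (h a c) => _ + _; apply. Qed.

Lemma smooth_local_spinor a c : smooth_mx (trivialized a c) (local_spinor a c).
Proof. by apply: smooth_real_col; case: psi_field => + _; apply. Qed.

Lemma spin_nabla_basis a c x i : spin_nabla gamma psi a c x (basis_vec R i) =
  cpartial_mx i (fun y => psi a (cinv (atlas c) y)) x +
  4^-1 *: \sum_j \sum_k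
    (inner (metric c) x (cov (metric c) i (fun y => row j (frame a c y)) x)
                        (row k (frame a c x)))%:C%C *:
      (gamma j *m (gamma k *m psi a (cinv (atlas c) x))).
Proof. exact: sum_basis_vec. Qed.

(** The spin connection along a coordinate field is the partial derivative plus the
    spin representation of the connection matrix of the frame, and Clifford
    multiplication by Ric(d_i) only sees its components in the frame. *)
Lemma local_killing a c i x : trivialized a c x ->
  partial_mx i (local_spinor a c) x =
  killing_mx g (metric c) (frame a c) mu i x *m local_spinor a c x.
Proof.
move=> Vx; have uG := metric_unit (@orth_frame a c) Vx.
case: (Vx) => p [cp ap] xE.
have := killing ap cp (basis_vec R i); rewrite /= xE spin_nabla_basis.
have -> : psi a p = psi a (cinv (atlas c) x) by rewrite -xE (cmapK cp).
move=> /(congr1 (@real_col R _ _)).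
rewrite real_colD real_colZ real_col_spin_rep /clifford_mult real_col_clifford.
rewrite -partial_mx_real_col -/g -/(local_spinor a c x) -/(local_spinor a c).
rewrite (_ : \matrix_(j, k) _ = frame_conn (metric c) (frame a c) i x); last first.
  by apply/matrixP => j k; rewrite mxE inner_cov_frame.
rewrite (_ : \row_j _ = frame_ricci (metric c) (frame a c) i x); last first.
  by apply/rowP => j; rewrite mxE inner_ricci_frame.
rewrite /killing_mx.
move: (cliff g _) (spin_rep g _) (partial_mx i _ x) (local_spinor a c x) => C Sp D P.
by move=> H; rewrite mulmxBl -scalemxAl -H addrK.
Qed.

Lemma smooth_local_killing_mx a c i :
  smooth_mx (trivialized a c) (killing_mx g (metric c) (frame a c) mu i).
Proof.
exact: (smooth_killing_mx g (@open_trivialized a c) (@smooth_metric a c)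
  (@smooth_frame a c) (@orth_frame a c) mu i).
Qed.

Lemma near_trivialized (a : sidx S) (c : idx M) p (P : set 'rV[R]_n) :
  sdom a p -> cdom (atlas c) p ->
  nbhs (cmap (atlas c) p) P -> nbhs p (fun q => [/\ sdom a q, cdom (atlas c) q &
    P (cmap (atlas c) q)]).
Proof.
move=> ap cp nP; case: (atlas_chart c) => oc _ _ cc _; case: hS => [[oa _] _ _ _ _].
have h1 : nbhs p (sdom a) := open_nbhs_nbhs (conj (oa a) ap).
have h2 : nbhs p (cdom (atlas c)) := open_nbhs_nbhs (conj oc cp).
have h3 : nbhs p (fun q => P (cmap (atlas c) q)) := cc p cp P nP.
by apply: filterS3 h1 h2 h3 => q.
Qed.

Let vanish : set M := [set p | exists a : sidx S, sdom a p /\ psi a p = 0].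
Let nonvanish : set M := [set p | exists a : sidx S, sdom a p /\ psi a p <> 0].

Let covered p : exists c : idx M, cdom (atlas c) p.
Proof. by case: hM => [[_ _ [_ h] _ _] _]; exact: h. Qed.

Let open_vanish : open vanish.
Proof.
rewrite openE => p [a [ap p0]]; have [c cp] := covered p.
have Vp : trivialized a c (cmap (atlas c) p) by exists p.
have h : nbhs (cmap (atlas c) p) (fun y => local_spinor a c y = 0).
  apply: (linear_system_unique (@open_trivialized a c) (@smooth_local_killing_mx a c)
    (@smooth_local_spinor a c)) => //.
    by move=> i x; exact: local_killing.
  by rewrite /local_spinor cmapK // p0 real_col0.
have := near_trivialized ap cp h; apply: filterS => q [aq cq].
by rewrite /local_spinor cmapK // => /real_col_eq0 q0; exists a.
Qed.

Let open_nonvanish : open nonvanish.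
Proof.
rewrite openE => p [a [ap p0]]; have [c cp] := covered p.
have Vp : trivialized a c (cmap (atlas c) p) by exists p.
have [k [l kl]] : exists k l, local_spinor a c (cmap (atlas c) p) k l != 0.
  apply: contrapT => h; apply: p0; apply: real_col_eq0; apply/matrixP => k l.
  rewrite [RHS]mxE; apply/eqP/negPn/negP => kl; apply: h; exists k, l.
  by rewrite /local_spinor cmapK.
have h : nbhs (cmap (atlas c) p) (fun y => local_spinor a c y k l != 0).
  have cont := smooth_continuous (@smooth_local_spinor a c k l) Vp.
  exact: (cont _ (open_nbhs_nbhs (conj (@open_neq _ (0 : R)) kl))).
have := near_trivialized ap cp h; apply: filterS => q [aq cq].
rewrite /local_spinor cmapK // => q0; exists a; split => // z.
by move: q0; rewrite z real_col0 mxE eqxx.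
Qed.

(** Vanishing does not depend on the trivialization; the set of zeros is open by
    uniqueness for the local system, and so is its complement by continuity. *)
Lemma ricci_killing_nowhere_zero : connected (@setT M) ->
  (exists (a : sidx S) p, sdom a p /\ psi a p <> 0) ->
  forall (a : sidx S) p, sdom a p -> psi a p <> 0.
Proof.
move=> connM [a0 [p0 [ap0 psi0]]] a p ap pz.
have glue (b b' : sidx S) q : sdom b q -> sdom b' q -> psi b q = 0 -> psi b' q = 0.
  by move=> bq b'q z; case: psi_field => _ /(_ b' b q b'q bq) ->; rewrite z mulmx0.
have NE : nonvanish = ~` vanish.
  apply/seteqP; split=> q.
    by move=> [b [bq qn]] [b' [b'q qz]]; apply: qn; exact: glue qz.
  have [b bq] : exists b : sidx S, sdom b q by case: hS => [[_ h] _ _ _ _]; exact: h.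
  by move=> h; exists b; split => // z; apply: h; exists b.
have E : nonvanish = setT.
  apply: connM.
  - by exists p0, a0.
  - by exists nonvanish; rewrite ?setTI.
  - by exists nonvanish; rewrite ?setTI // NE; exact: open_closedC.
have : nonvanish p by rewrite E.
by move=> [b [bp bn]]; apply: bn; exact: glue pz.
Qed.

End RicciKilling.
(** * An open subset isometric to a product *)

Section ProductSubset.
Variables (R : realType) (n n1 n2 : nat).
Variables (M : riem_data R n) (hM : is_riemannian M) (U : set M).
Variables (U1 : riem_data R n1) (U2 : riem_data R n2).
Hypotheses (hU1 : is_riemannian U1) (hU2 : is_riemannian U2).
Hypothesis iso : open_isometric U (riem_prod U1 U2).
Variables (c1 : idx U1) (c2 : idx U2).

Let d := prod_chart (atlas c1) (atlas c2).

Let d_chart : is_chart d.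
Proof. by apply: prod_chart_is_chart; exact: atlas_chart. Qed.

Let dK q : cdom d q -> cinv d (cmap d q) = q.
Proof. by case: d_chart => _ _ h _ _; exact: h. Qed.

(** The Jacobian [J] of the isometry satisfies [G = J *m G' *m J^T] with [G]
    invertible, so that it has a right inverse; by the chain rule the Jacobian of
    the inverse map is a left inverse. *)
Lemma isometric_dim (q : riem_prod U1 U2) : cdom d q ->
  (forall (c : idx M) x, crange (atlas c) x -> metric c x \in unitmx) ->
  n = (n1 + n2)%N.
Proof.
move=> dq unitM; case: iso => oU [f [h [[hf fh] [cf ch] sF sH iF]]].
pose p := h q; have [Up fp] := fh q.
have [c cp] : exists c : idx M, cdom (atlas c) p.
  by case: hM => [[_ _ [_ cov] _ _] _]; exact: cov.
have cx : crange (atlas c) (cmap (atlas c) p) by exists p.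
apply/eqP; rewrite eqn_leq; apply/andP; split.
  have := iF c (c1, c2) p Up cp; rewrite fp => /(_ dq) /=.
  move: (jacobian _ _) (block_mx _ _ _ _) => J G' e.
  have := mulmxV (unitM c _ cx); rewrite e -!mulmxA; exact: mulmx1_min.
pose H y := cmap (atlas c) (h (cinv d y)).
pose F x := cmap d (f (cinv (atlas c) x)).
pose W := cmap d @` (cdom d `&` h @^-1` cdom (atlas c)).
pose V := cmap (atlas c) @` (U `&` cdom (atlas c) `&` f @^-1` cdom d).
have cK := cmapK hM.
have oc : open (cdom (atlas c)) by case: (atlas_chart hM c).
have od : open (cdom d) by case: d_chart.
have oW : open W.
  by apply: open_chart_image => //; apply: open_comp => // y _; exact: ch.
have oV : open V.
  rewrite /V [U `&` _]setIC -setIA; apply: open_chart_image; first exact: atlas_chart.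
  rewrite openE => p' [Up' dp']; apply: filterI; first exact: (open_nbhs_nbhs (conj oU Up')).
  by apply: (cf p' Up'); exact: (open_nbhs_nbhs (conj od dp')).
have Wq : W (cmap d q) by exists q.
have VHq : V (H (cmap d q)).
  by rewrite /H dK //; exists p => //; split => //=; rewrite fp.
have FH z : W z -> F (H z) = z.
  move=> [q' [dq' cq'] <-]; rewrite /F /H dK // cK //.
  by have [_ ->] := fh q'.
exact: mulmx1_min (jacobian_comp_id oW oV Wq VHq (sH c (c1, c2)) (sF c (c1, c2)) FH).
Qed.

End ProductSubset.

(** The product chart composed with the isometry is compatible with the atlas, so
    it belongs to it by maximality; in this chart the isometry reads as the
    identity and transports the block metric unchanged. *)
Lemma product_chart (R : realType) (n1 n2 : nat)
    (M : riem_data R (n1 + n2)) (hM : is_riemannian M) (U : set M)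
    (U1 : riem_data R n1) (U2 : riem_data R n2)
    (hU1 : is_riemannian U1) (hU2 : is_riemannian U2)
    (iso : open_isometric U (riem_prod U1 U2)) (c1 : idx U1) (c2 : idx U2) :
  exists c : idx M, crange (atlas c) = crange (prod_chart (atlas c1) (atlas c2)) /\
    forall x, crange (atlas c) x -> metric c x = prod_metric (metric c1) (metric c2) x.
Proof.
set d := prod_chart _ _.
have d_chart : is_chart d by apply: prod_chart_is_chart; exact: atlas_chart.
case: (d_chart) => od ord dK cmd cid.
case: iso => oU [f [h [[hf fh] [cf ch] sF sH iF]]].
pose k : chart R M (n1 + n2) := {| cdom := U `&` f @^-1` cdom d;
  cmap := cmap d \o f; cinv := h \o cinv d |}.
have kran : crange k = crange d.
  apply/seteqP; split=> [_ [p [Up dp] <-]|_ [q dq <-]]; first by exists (f p).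
  by have [Uq fq] := fh q; exists (h q); rewrite /= ?fq //; split => //=; rewrite fq.
have k_chart : is_chart k.
  split.
  - rewrite openE => p [Up dp]; apply: filterI; first exact: (open_nbhs_nbhs (conj oU Up)).
    by apply: (cf p Up); exact: (open_nbhs_nbhs (conj od dp)).
  - by rewrite kran.
  - by move=> p [Up dp]; exact: etrans (congr1 h (dK _ dp)) (hf _ Up).
  - by move=> p [Up dp]; apply: continuous_comp; [exact: cf|exact: cmd].
  - move=> x; rewrite kran => dx; apply: continuous_comp; first exact: cid.
    exact: ch.
have [c cE] : exists c : idx M, atlas c = k.
  case: hM => [[_ _ _ _ maxM] _]; apply: maxM => // c; split.
    rewrite /overlap /= setIA [cdom _ `&` U]setIC.
    exact: (sF c (c1, c2)).
  rewrite (_ : overlap k (atlas c) = cmap d @` (cdom d `&` h @^-1` cdom (atlas c))).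
    exact: (sH c (c1, c2)).
  apply/seteqP; split=> [_ [p [[Up dp] cp] <-]|_ [q [dq cq] <-]].
    by exists (f p) => //; split => //=; rewrite hf.
  by have [Uq fq] := fh q; exists (h q); rewrite /= ?fq //; split => //; split => //=; rewrite fq.
exists c; rewrite cE; split => // x [p [Up dp] <-].
have cp : cdom (atlas c) p by rewrite cE.
have := iF c (c1, c2) p Up cp dp; rewrite /= cE.
rewrite (@jacobian_id _ _ _ (crange d)) //; last 2 first.
- by rewrite -kran; exists p.
- move=> _ [q dq <-]; have [_ fq] := fh q.
  exact: etrans (congr1 (fun r => cmap d (f (h r))) (dK q dq)) (congr1 (cmap d) fq).
rewrite trmx1 mulmx1 mul1mx => ->.
have -> : cinv k (cmap k p) = p := etrans (congr1 h (dK _ dp)) (hf _ Up).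
by [].
Qed.

(** * Absence of Ricci Killing spinors *)

Theorem theorem3p7 (R : realType) (n n1 n2 : nat)
    (gamma : 'I_n -> 'M[R[i]]_(spinor_rank n)) (hgamma : clifford_rep gamma)
    (M : riem_data R n) (hM : is_riemannian M)
    (hconn : connected (@setT M))
    (S : spin_data M (spinor_rank n)) (hS : is_spin_structure gamma S)
    (U : set M) (U1 : riem_data R n1) (U2 : riem_data R n2)
    (hU1 : is_riemannian U1) (hU2 : is_riemannian U2)
    (hnf1 : ~ ricci_flat U1) (hnf2 : ~ ricci_flat U2)
    (hiso : open_isometric U (riem_prod U1 U2)) :
  ~ exists psi : sidx S -> M -> 'cV[R[i]]_(spinor_rank n),
      ricci_killing_spinor gamma psi.
Proof.
move=> [psi [psi_field psi_ne [mu mu0 killing]]].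
have curved m (N : riem_data R m) : ~ ricci_flat N -> exists (c : idx N) p i,
    cdom (atlas c) p /\ row i (ricci (metric c) (cmap (atlas c) p)) != 0.
  move=> nf; apply: contrapT => h; apply: nf => c _ [p cp <-].
  apply/row_matrixP => i; rewrite row0; apply/eqP/negPn/negP => ri.
  by apply: h; exists c, p, i.
have [c1 [p1 [i [cp1 ric1]]]] := curved _ _ hnf1.
have [c2 [p2 [j [cp2 ric2]]]] := curved _ _ hnf2.
have covered p : exists a : sidx S, sdom a p by case: hS => [[_ h] _ _ _ _]; exact: h.
have unitM (c : idx M) x : crange (atlas c) x -> metric c x \in unitmx.
  move=> [p cp <-]; have [a ap] := covered p.
  by apply: (metric_unit (orth_frame hS (a := a) (c := c))); exists p.
have E := isometric_dim hM hU1 hU2 hiso (c1 := c1) (c2 := c2) (q := (p1, p2)) (conj cp1 cp2) unitM.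
subst n.
have [c [ranE metE]] := product_chart hM hU1 hU2 hiso c1 c2.
pose x : 'rV[R]_(n1 + n2) := row_mx (cmap (atlas c1) p1) (cmap (atlas c2) p2).
have xc : crange (atlas c) x by rewrite ranE; exists (p1, p2).
have [p cp xE] := xc; have [a ap] := covered p.
have Vx : trivialized a c x by exists p.
apply: (ricci_killing_nowhere_zero hM hS psi_field killing hconn psi_ne ap).
apply: real_col_eq0; rewrite -(cmapK hM cp) xE -/(local_spinor psi a c x).
have oV : open (trivialized a c) by exact: (open_trivialized hM hS).
have GG y : trivialized a c y -> metric c y = prod_metric (metric c1) (metric c2) y.
  by move=> /trivialized_crange; exact: metE.
have unitV y : trivialized a c y -> prod_metric (metric c1) (metric c2) y \in unitmx.
  by move=> Vy; rewrite -GG //; exact/unitM/trivialized_crange/Vy.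
have mu0' : mu != 0 by apply/eqP.
apply: (killing_spinor_eq0 (real_clifford_rep hgamma) oV (smooth_metric hM a c)
  (smooth_frame hS a c) (@sym_metric _ _ _ hM _ a c) (@orth_frame _ _ _ _ _ hS a c) mu0'
  (smooth_local_spinor psi_field a c) (@local_killing _ _ _ _ hM _ hS _ _ killing a c)
  (i := lshift n2 i) (j := rshift n1 j) Vx).
- by rewrite (curvature_mx_ext oV GG _ _ Vx) (curvature_prod_lr oV unitV).
- by rewrite (cov_ricci_field_ext oV GG _ _ Vx) (cov_ricci_field_prod_lr oV unitV).
- by rewrite (cov_ricci_field_ext oV GG _ _ Vx) (cov_ricci_field_prod_rl oV unitV).
- rewrite (ricci_field_ext oV GG _ Vx) (ricci_field_ext oV GG (rshift n1 j) Vx) (GG _ Vx).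
  exact: (ricci_field_prod_orth oV unitV).
- apply: contra_neq ric1; rewrite (ricci_ext oV GG Vx) (ricci_prod oV unitV Vx).
  by rewrite row_mxKl /block_mx rowKu row_row_mx -row_mx0 => /eq_row_mx[].
- apply: contra_neq ric2; rewrite (ricci_ext oV GG Vx) (ricci_prod oV unitV Vx).
  by rewrite row_mxKr /block_mx rowKd row_row_mx -row_mx0 => /eq_row_mx[].
Qed.
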